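(* Let $A\in\mathbb{R}^{n_x\times n_x}$, $B\in\mathbb{R}^{n_x\times n_u}$, $E\in\mathbb{R}^{n_x\times n_w}$, $K\in\mathbb{R}^{n_u\times n_x}$, $\Sigma_w\succ 0$ in $\mathbb{R}^{n_w\times n_w}$ and $\varepsilon\in(0,1)$. Assume $\|A+BK\|<1$, $(A+BK,E)$ is reachable, and $B\neq 0$. Let $P\succ0$ be the solution of $(A+BK)P(A+BK)^\top-P+E\Sigma_wE^\top=0$, and suppose $r>0$ satisfies $r^2>\frac1\varepsilon\operatorname{Tr}(P)$. Consider the system $x_{t+1}=Ax_t+Bu_t+Ew_t$ with the event-triggered control $u_t=K\hat x_t$, where $\hat x_t=x_{t_k}$ for $t\in[t_k,t_{k+1})$, $t_0=0$, and the triggering times are $$t_{k+1}=\min\{t>t_k:\ \|K(x_{t_k}-x_t)\|>\sigma_2\}.$$ If $$\sigma_2\le\frac{1-\|A+BK\|}{\|B\|}\left(r-\sqrt{\frac1\varepsilon\operatorname{Tr}(P)}\right),$$ then ultimate boundedness with $\mathcal{D}=\{x\in\mathbb{R}^{n_x}:\|x\|^2-r^2\le0\}$ is guaranteed: for every initial state $x_0$ there exists $T=T(x_0)>0$ such that $\sup_{\mathbb{P}\in\mathcal{P}_t}\mathbb{P}\text{-CVaR}_\varepsilon[\|x_t\|^2-r^2]\le0$ for all $t\ge T$.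
   Context: $\|\cdot\|$ is the Euclidean norm on vectors and the maximum singular value on matrices; $M\succ 0$ means positive definite. Reachability of $(A+BK,E)$ means $\operatorname{rank}[E,(A+BK)E,\dots,(A+BK)^{n_x-1}E]=n_x$. CVaR: for a probability distribution $\mathbb{P}$ of a random vector $\xi$ and a measurable loss $L$, at level $\varepsilon\in(0,1)$, $\mathbb{P}\text{-CVaR}_\varepsilon[L(\xi)]=\inf_{\beta\in\mathbb{R}}\{\beta+\frac1\varepsilon\mathbb{E}_{\mathbb{P}}[(L(\xi)-\beta)^+]\}$, where $x^+=\max\{x,0\}$. The worst-case CVaR over a set of distributions is the supremum of CVaR over that set. Setting: $x_0$ is a given deterministic vector and the disturbances $w_t\in\mathbb{R}^{n_w}$, $t\in\mathbb{Z}_{\ge0}$, are i.i.d. with mean zero and covariance $\Sigma_w$, but their distribution is otherwise unknown. For $t\ge1$, $\bar w_t=[w_0^\top,\dots,w_{t-1}^\top]^\top$, and $\mathcal{P}_t$ is the set of all probability distributions of $\bar w_t$ on $\mathbb{R}^{n_wt}$ with mean zero and covariance $I_t\otimes\Sigma_w$. Under the event-triggered control, $x_t$ is a function of $x_0$ and $\bar w_t$. With $e_t=\hat x_t-x_t$ the closed loop reads $x_{t+1}=(A+BK)x_t+BKe_t+Ew_t$. If the set defining $t_{k+1}$ is empty, $t_{k+1}=\infty$; at a triggering time $\hat x_t$ is reset to $x_t$ (so $e_t=0$). *)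

(* Defs.v *)
From HB Require Import structures.
From mathcomp Require Import all_boot all_order all_algebra.
From mathcomp Require Export mxtens.
From mathcomp Require Import all_classical all_reals all_analysis.

Set Implicit Arguments.
Unset Strict Implicit.
Unset Printing Implicit Defensive.

Import Order.TTheory GRing.Theory Num.Theory.

Local Open Scope classical_set_scope.
Local Open Scope ring_scope.

(* The library norm [`|v|] on matrices is the sup norm, hence [norm2] for the
   Euclidean norm of column vectors. *)
Definition norm2 (R : realType) (n : nat) (v : 'cV[R]_n) : R :=
  Num.sqrt (\sum_i v i 0 ^+ 2).

(* The singular values of [M] are the square roots of the eigenvalues of
   [M^T M]; the maximum is taken as a [sup], so that it is [0] for a matrix
   without columns. *)
Definition max_singular_value (R : realType) (m n : nat) (M : 'M[R]_(m, n)) : R :=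
  sup [set Num.sqrt a | a in [set a | eigenvalue (M^T *m M) a]].

Definition posdefmx (R : realType) (n : nat) (M : 'M[R]_n) : Prop :=
  M^T = M /\ forall v : 'cV[R]_n, v != 0 -> 0 < (v^T *m M *m v) 0 0.

Definition reachable (R : realType) (n m : nat)
    (F : 'M[R]_n) (G : 'M[R]_(n, m)) : Prop :=
  \rank (\mxrow_(j < n) (F ^+ j *m G)) = n.

Definition CVaR d (T : measurableType d) (R : realType) (P : probability T R)
    (eps : R) (L : T -> R) : \bar R :=
  ereal_inf
    [set (beta%:E + eps^-1%:E * 'E_P[(fun xi => Num.max (L xi - beta) 0)%R])%E
      | beta in [set: R]].

Definition worst_case_CVaR d (T : measurableType d) (R : realType)
    (Ps : set (probability T R)) (eps : R) (L : T -> R) : \bar R :=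
  ereal_sup [set CVaR P eps L | P in Ps].

(* Membership in [Lfun P 2] says that the second moments exist. *)
Definition moment_ambiguity_set (R : realType) (m : nat) (S : 'M[R]_m) :
    set (probability (m.-tuple R) R) :=
  [set P : probability (m.-tuple R) R | let xi (k : 'I_m) := fun v : m.-tuple R => tnth v k in
     [/\ forall k, xi k \in Lfun P 2%:E,
         forall k, ('E_P[xi k] = 0)%E &
         forall k l, covariance P (xi k) (xi l) = (S k l)%:E]].

(* [1%:M *t Sigma_w] is the Kronecker product of the identity of size [t] with
   [Sigma_w]; its index [mxtens_index (s, i)] stands for the i-th coordinate of
   the s-th block. *)
Definition disturbance_ambiguity_set (R : realType) (nw : nat)
    (Sigma_w : 'M[R]_nw) (t : nat) :
    set (probability ((t * nw).-tuple R) R) :=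
  moment_ambiguity_set ((1%:M : 'M[R]_t) *t Sigma_w).
Arguments disturbance_ambiguity_set {R nw} Sigma_w t.

(* The vector obtained by stacking [w 0], ..., [w t.-1], in the index order of
   the Kronecker product above. *)
Definition stack (R : realType) (nw : nat) (w : nat -> 'cV[R]_nw) (t : nat) :
    (t * nw).-tuple R :=
  [tuple w (mxtens_unindex k).1 (mxtens_unindex k).2 0 | k < t * nw].

(* The least [t] with [p t], or [None] (standing for infinity) if there is none. *)
Definition first_time (p : pred nat) : option nat :=
  if pselect (exists t, p t) is left h then Some (ex_minn h) else None.

(* The triggering times t_k of the state trajectory [x]. *)
Fixpoint trigger_time (R : realType) (nx nu : nat) (K : 'M[R]_(nu, nx))
    (sigma2 : R) (x : nat -> 'cV[R]_nx) (k : nat) : option nat :=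
  if k is k'.+1 then
    obind (fun tk => first_time
             (fun t => (tk < t)%N && (sigma2 < norm2 (K *m (x tk - x t)))))
          (trigger_time K sigma2 x k')
  else Some 0%N.

Definition before_time (t : nat) (s : option nat) : bool :=
  if s is Some s' then (t < s')%N else true.

Definition event_triggered_trajectory (R : realType) (nx nu nw : nat)
    (A : 'M[R]_nx) (B : 'M[R]_(nx, nu)) (E : 'M[R]_(nx, nw))
    (K : 'M[R]_(nu, nx)) (sigma2 : R) (x0 : 'cV[R]_nx)
    (w : nat -> 'cV[R]_nw) (x : nat -> 'cV[R]_nx) : Prop :=
  exists (u : nat -> 'cV[R]_nu) (xhat : nat -> 'cV[R]_nx),
    [/\ x 0%N = x0,
        forall t, x t.+1 = A *m x t + B *m u t + E *m w t,
        forall t, u t = K *m xhat t &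
        forall k tk t, trigger_time K sigma2 x k = Some tk -> (tk <= t)%N ->
          before_time t (trigger_time K sigma2 x k.+1) -> xhat t = x tk].

(* The state at time [t], [x t], as a function of the disturbances up to [t.-1]
   stacked in one vector. *)
Definition event_triggered_state (R : realType) (nx nu nw : nat)
    (A : 'M[R]_nx) (B : 'M[R]_(nx, nu)) (E : 'M[R]_(nx, nw))
    (K : 'M[R]_(nu, nx)) (sigma2 : R) (x0 : 'cV[R]_nx)
    (x : forall t : nat, (t * nw).-tuple R -> 'cV[R]_nx) : Prop :=
  forall w : nat -> 'cV[R]_nw,
    event_triggered_trajectory A B E K sigma2 x0 w (fun t => x t (stack w t)).

(* [event_triggered_state] is never vacuous. *)
Section existence.
Context (R : realType) (nx nu nw : nat)
    (A : 'M[R]_nx) (B : 'M[R]_(nx, nu)) (E : 'M[R]_(nx, nw))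
    (K : 'M[R]_(nu, nx)) (sigma2 : R) (x0 : 'cV[R]_nx).

Fixpoint closed_loop (w : nat -> 'cV[R]_nw) t : 'cV[R]_nx * 'cV[R]_nx :=
  if t is t'.+1 then
    let x' := A *m (closed_loop w t').1 + B *m (K *m (closed_loop w t').2) + E *m w t' in
    (x', if sigma2 < norm2 (K *m ((closed_loop w t').2 - x')) then x' else (closed_loop w t').2)
  else (x0, x0).

Lemma closed_loop_ext w w' t : (forall s, (s < t)%N -> w s = w' s) -> closed_loop w t = closed_loop w' t.
Proof.
elim: t => //= t IH h; rewrite IH ?h// => s st; apply: h; exact: ltnW.
Qed.

Lemma first_timeP p : match first_time p with
  | Some t => p t /\ forall s, p s -> (t <= s)%N | None => forall t, ~~ p t end.
Proof.
rewrite /first_time; case: pselect => [h|h].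
  by case: ex_minnP => m pm hm.
by move=> t; apply/negP => pt; apply: h; exists t.
Qed.

Lemma closed_loop_trajectory w :
  event_triggered_trajectory A B E K sigma2 x0 w (fun t => (closed_loop w t).1).
Proof.
exists (fun t => K *m (closed_loop w t).2), (fun t => (closed_loop w t).2); split => //.
set x := fun t => (closed_loop w t).1.
have step k tk : trigger_time K sigma2 x k = Some tk ->
    (closed_loop w tk).2 = x tk -> forall t, (tk <= t)%N ->
    before_time t (trigger_time K sigma2 x k.+1) -> (closed_loop w t).2 = x tk.
  move=> hk e; elim => [|t IH]; first by rewrite leqn0 => /eqP h0; subst tk.
  rewrite leq_eqVlt => /orP[/eqP h0|tkt bt]; first by subst tk.
  have bt' : before_time t (trigger_time K sigma2 x k.+1).
    by move: bt; case: trigger_time => //= a; apply: ltn_trans.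
  have e' := IH tkt bt'.
  have : ~~ (sigma2 < norm2 (K *m (x tk - x t.+1))).
    move: bt; rewrite [trigger_time _ _ _ _]/= hk /=.
    have := first_timeP (fun t => (tk < t)%N && (sigma2 < norm2 (K *m (x tk - x t)))).
    case: first_time => [a [_ h] ta|h _]; last first.
      by have := h t.+1; rewrite tkt.
    apply/negP => c; have := h t.+1; rewrite tkt c => /(_ isT).
    by rewrite leqNgt; move: ta => /= ->.
  by rewrite /= e' /x /= e' => /negbTE ->.
have all k : forall tk, trigger_time K sigma2 x k = Some tk ->
    (closed_loop w tk).2 = x tk.
  elim: k => [tk [<-]//|k IH tk'] /=.
  case hk : (trigger_time K sigma2 x k) => [tk|]//= hk'.
  have := first_timeP (fun t => (tk < t)%N && (sigma2 < norm2 (K *m (x tk - x t)))).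
  rewrite hk'; case: tk' hk' => [|t] hk' [/andP[tkt c] _] //.
  have := step _ _ hk (IH _ hk) t tkt; rewrite /= hk /= hk' /= => /(_ (ltnSn t)) e.
  by move: c e; rewrite /x /= => c e; move: c; rewrite e => ->.
by move=> k tk t hk; apply: step => //; apply: all hk.
Qed.

Definition unstack t (v : (t * nw).-tuple R) (s : nat) : 'cV[R]_nw :=
  if insub s is Some s' then \col_i tnth v (mxtens_index (s' : 'I_t, i)) else 0.

Lemma event_triggered_state_exists :
  exists x : forall t : nat, (t * nw).-tuple R -> 'cV[R]_nx,
    event_triggered_state A B E K sigma2 x0 x.
Proof.
exists (fun t v => (closed_loop (unstack v) t).1) => w.
rewrite (_ : (fun t => _) = (fun t => (closed_loop w t).1)).
  exact: closed_loop_trajectory.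
apply/funext => t; congr (_.1); apply: closed_loop_ext => s hs.
apply/colP => i; rewrite /unstack insubT mxE tnth_mktuple.
by rewrite mxtens_indexK.
Qed.

End existence.

(* Main.v *)
Require Import Defs.
From mathcomp Require Import all_boot all_order all_algebra.
From mathcomp Require Import all_classical all_reals all_analysis.
From mathcomp Require Import ring lra.

Set Implicit Arguments.
Unset Strict Implicit.
Unset Printing Implicit Defensive.

Import Order.TTheory GRing.Theory Num.Theory.
Import numFieldNormedType.Exports.

Local Open Scope classical_set_scope.
Local Open Scope ring_scope.

(* Let F = A + BK, a = ||F||, sp = sqrt (Tr P / eps) and c = r - sp.  Split the state
   as x = z + y, where y is the response to the noise and z is driven by the
   triggering errors b_t = BK (xhat_t - x_t), with ||b_t|| <= (1 - a) c; then
   ||z_t|| <= c + a^t ||x_0|| and E ||y_t||^2 <= Tr P.  With beta = - r sp, Young's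
   inequality bounds the CVaR by 0 up to an error of order a^t, and

     gap = r c + (r / sp) ||y||^2 - ||z + y||^2
         = (r / c) (c^2 - ||z||^2) + (c / sp) ||(sp / c) z - y||^2

   measures the slack.  As sigma_2 may attain its bound, this error has to be absorbed
   to get a finite T.  If gap is almost 0 at time t, the trajectory is nearly
   determined: with V = F^T / a, z_(t-k) is close to V^k z_t and b_(t-k-1) to
   (1 - a) V^k z_t; the latter is far from 0, so no triggering took place recently.
   Hence some linear function l of the noise is almost 0 whenever gap is.  If
   N = lim E [l y_t^T] is nonzero, the quadratic

     (r / sp) ||y||^2 + lambda (mu ||l||^2 - 2 <N y, l>) + lambda ||N||^2

   dominates the loss pointwise and has expectation at most (r / sp) Tr P for every
   distribution of the ambiguity set.  There are two sources of such l: the identity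
   V^T V z = z, and the fact that xhat is constant over consecutive times.  If N
   vanishes for all of them, then BK = 0 and the error is absent. *)

(** * Euclidean norm and operator bounds *)

Lemma mulmx_cV_eq0 (R : pzRingType) m n (M : 'M[R]_(m, n)) :
  (forall v : 'cV[R]_n, M *m v = 0) -> M = 0.
Proof.
move=> h; apply/matrixP => i j; have /matrixP/(_ i 0) := h (delta_mx j 0).
by rewrite -colE !mxE.
Qed.

Section inner_product.
Context {R : realType}.
Implicit Types m n : nat.

Definition dot n (u v : 'cV[R]_n) : R := (u^T *m v) 0 0.

Lemma dotE n (u v : 'cV[R]_n) : dot u v = \sum_i u i 0 * v i 0.
Proof. by rewrite /dot mxE; apply: eq_bigr => i _; rewrite mxE. Qed.

Lemma dotC n (u v : 'cV[R]_n) : dot u v = dot v u.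
Proof. by rewrite !dotE; apply: eq_bigr => i _; rewrite mulrC. Qed.

Lemma dotDr n (u v w : 'cV[R]_n) : dot u (v + w) = dot u v + dot u w.
Proof. by rewrite /dot mulmxDr mxE. Qed.

Lemma dotNr n (u v : 'cV[R]_n) : dot u (- v) = - dot u v.
Proof. by rewrite /dot mulmxN mxE. Qed.

Lemma dotZr n a (u v : 'cV[R]_n) : dot u (a *: v) = a * dot u v.
Proof. by rewrite /dot -scalemxAr mxE. Qed.

Lemma dotDl n (u v w : 'cV[R]_n) : dot (v + w) u = dot v u + dot w u.
Proof. by rewrite dotC dotDr !(dotC u). Qed.

Lemma dotNl n (u v : 'cV[R]_n) : dot (- v) u = - dot v u.
Proof. by rewrite dotC dotNr dotC. Qed.

Lemma dotZl n a (u v : 'cV[R]_n) : dot (a *: v) u = a * dot v u.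
Proof. by rewrite dotC dotZr dotC. Qed.

Definition dot_expand := (dotDr, dotDl, dotNr, dotNl, dotZr, dotZl).

Lemma dot_mul m n (M : 'M[R]_(m, n)) u v : dot u (M *m v) = dot (M^T *m u) v.
Proof. by rewrite /dot trmx_mul trmxK mulmxA. Qed.

Lemma dot_ge0 n (v : 'cV[R]_n) : 0 <= dot v v.
Proof. by rewrite dotE sumr_ge0// => i _; rewrite -expr2 sqr_ge0. Qed.

Lemma dot_eq0 n (v : 'cV[R]_n) : dot v v = 0 -> v = 0.
Proof.
move=> /eqP; rewrite dotE psumr_eq0; last by move=> i _; rewrite -expr2 sqr_ge0.
move=> /allP h; apply/colP => i; rewrite mxE.
by apply/eqP; have := h i (mem_index_enum _); rewrite mulf_eq0 orbb.
Qed.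

Lemma norm2_ge0 n (v : 'cV[R]_n) : 0 <= norm2 v. Proof. exact: sqrtr_ge0. Qed.

Lemma norm2_sqr n (v : 'cV[R]_n) : norm2 v ^+ 2 = dot v v.
Proof.
rewrite /norm2 sqr_sqrtr; first by rewrite dotE; apply: eq_bigr => i _; rewrite expr2.
by apply: sumr_ge0 => i _; exact: sqr_ge0.
Qed.

Lemma norm20 n : norm2 (0 : 'cV[R]_n) = 0.
Proof. by apply/eqP; rewrite -sqrf_eq0 norm2_sqr dotE big1// => i _; rewrite mxE mul0r. Qed.

Lemma norm2_le0 n (v : 'cV[R]_n) : norm2 v <= 0 -> v = 0.
Proof.
move=> h; apply: dot_eq0; rewrite -norm2_sqr.
suff -> : norm2 v = 0 by rewrite expr0n.
by apply: le_anti; rewrite h norm2_ge0.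
Qed.

Lemma norm2N n (v : 'cV[R]_n) : norm2 (- v) = norm2 v.
Proof. by rewrite /norm2; congr Num.sqrt; apply: eq_bigr => i _; rewrite mxE sqrrN. Qed.

Lemma norm2Z n a (v : 'cV[R]_n) : norm2 (a *: v) = `|a| * norm2 v.
Proof.
apply/eqP; rewrite -(@eqrXn2 _ 2) ?mulr_ge0 ?norm2_ge0//.
by rewrite exprMn !norm2_sqr !dot_expand real_normK ?num_real//; apply/eqP; ring.
Qed.

Lemma norm2_le n (v : 'cV[R]_n) k : 0 <= k -> dot v v <= k ^+ 2 -> norm2 v <= k.
Proof. by move=> k0; rewrite -norm2_sqr ler_pXn2r// nnegrE norm2_ge0. Qed.

(* Nonnegativity of [t |-> q (u + t v)] for the quadratic form [q] of [S]. *)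
Lemma psd_cauchy_schwarz n (S : 'M[R]_n) (u v : 'cV[R]_n) : S^T = S ->
  (forall v, 0 <= dot v (S *m v)) ->
  dot u (S *m v) ^+ 2 <= dot u (S *m u) * dot v (S *m v).
Proof.
move=> Ssym S0.
have e x y : 0 <= x ^+ 2 * dot u (S *m u) + 2 * x * y * dot u (S *m v)
    + y ^+ 2 * dot v (S *m v).
  have := S0 (x *: u + y *: v); rewrite mulmxDr -!scalemxAr !dot_expand.
  rewrite (_ : dot v (S *m u) = dot u (S *m v)); last by rewrite dot_mul Ssym dotC.
  by congr (0 <= _); ring.
set A := dot u (S *m u) in e *; set B := dot u (S *m v) in e *.
set C := dot v (S *m v) in e *.
have [C0|C0] := ltrP 0 C.
  have := e C (- B); rewrite (_ : _ + _ = C * (A * C - B ^+ 2)); last by ring.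
  by rewrite pmulr_rge0// subr_ge0.
have C00 : C = 0 by apply: le_anti; rewrite C0 S0.
rewrite C00 mulr0.
have := e (- B) ((A + 1) / 2); rewrite C00.
have -> : (- B) ^+ 2 * A + 2 * (- B) * ((A + 1) / 2) * B + ((A + 1) / 2) ^+ 2 * 0 =
   - B ^+ 2 by field.
by rewrite oppr_ge0.
Qed.

Lemma cauchy_schwarz n (u v : 'cV[R]_n) : dot u v <= norm2 u * norm2 v.
Proof.
have h : dot u v ^+ 2 <= dot u u * dot v v.
  have := @psd_cauchy_schwarz n 1%:M u v (trmx1 _ _); rewrite !mul1mx; apply.
  by move=> w; rewrite mul1mx dot_ge0.
have [uv|uv] := lerP (dot u v) 0.
  by apply: (le_trans uv); rewrite mulr_ge0 ?norm2_ge0.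
rewrite -(@ler_pXn2r _ 2) ?nnegrE ?mulr_ge0 ?norm2_ge0//; last exact: ltW.
by rewrite exprMn !norm2_sqr.
Qed.

Lemma norm2D n (u v : 'cV[R]_n) : norm2 (u + v) <= norm2 u + norm2 v.
Proof.
apply: norm2_le; first by rewrite addr_ge0 ?norm2_ge0.
rewrite !dot_expand (dotC v u) sqrrD !norm2_sqr.
have := cauchy_schwarz u v; lra.
Qed.

Lemma norm2B n (u v : 'cV[R]_n) : norm2 (u - v) <= norm2 u + norm2 v.
Proof. by rewrite -(norm2N v) norm2D. Qed.

(** Stands in for the spectral norm: any upper bound is allowed, so sums, products, powers and
    transposes need no eigenvalues. *)
Definition opbound m n (M : 'M[R]_(m, n)) k := forall v, norm2 (M *m v) <= k * norm2 v.

Lemma opboundD m n (M N : 'M[R]_(m, n)) k l :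
  opbound M k -> opbound N l -> opbound (M + N) (k + l).
Proof.
move=> Mk Nl v; rewrite mulmxDl mulrDl.
by apply: le_trans (norm2D _ _) _; rewrite lerD.
Qed.

Lemma opboundN m n (M : 'M[R]_(m, n)) k : opbound M k -> opbound (- M) k.
Proof. by move=> Mk v; rewrite mulNmx norm2N. Qed.

Lemma opboundM m n p (M : 'M[R]_(m, n)) (N : 'M[R]_(n, p)) k l : 0 <= k ->
  opbound M k -> opbound N l -> opbound (M *m N) (k * l).
Proof.
move=> k0 Mk Nl v; rewrite -mulmxA; apply: le_trans (Mk _) _.
by rewrite -mulrA ler_wpM2l.
Qed.

Lemma opboundW m n (M : 'M[R]_(m, n)) k l : k <= l -> opbound M k -> opbound M l.
Proof. by move=> kl h v; apply: le_trans (h v) _; rewrite ler_wpM2r ?norm2_ge0. Qed.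

Lemma opbound_exp n (M : 'M[R]_n) k j : 0 <= k -> opbound M k -> opbound (M ^+ j) (k ^+ j).
Proof.
move=> k0 Mk; elim: j => [|j IH]; first by move=> v; rewrite !expr0 mul1mx mul1r.
by rewrite !exprS -mulmxE; apply: opboundM.
Qed.

(** ||M^T v||^2 = <v, M M^T v> <= k ||v|| ||M^T v||; divide by ||M^T v||. *)
Lemma opbound_tr m n (M : 'M[R]_(m, n)) k : 0 <= k -> opbound M k -> opbound M^T k.
Proof.
move=> k0 Mk v; set u := M^T *m v.
have : norm2 u ^+ 2 <= norm2 u * (k * norm2 v).
  rewrite norm2_sqr {1}/u -dot_mul; apply: le_trans (cauchy_schwarz _ _) _.
  rewrite mulrC [leRHS]mulrCA mulrA; apply: ler_wpM2r; first exact: norm2_ge0.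
  exact: Mk.
have := norm2_ge0 u; rewrite le_eqVlt => /predU1P[<- _|u0].
  by rewrite mulr_ge0 ?norm2_ge0.
by rewrite expr2 ler_pM2l.
Qed.

(** Cauchy-Schwarz on each row, and a sum of squares of nonnegative numbers is at most the square of
    their sum. *)
Lemma opbound_exists m n (M : 'M[R]_(m, n)) : exists2 k, 0 <= k & opbound M k.
Proof.
pose f i := norm2 (row i M)^T.
have f0 : 0 <= \sum_i f i by apply: sumr_ge0 => i _; exact: norm2_ge0.
exists (\sum_i f i) => // v; apply: norm2_le; first by rewrite mulr_ge0 ?norm2_ge0.
rewrite dotE exprMn; apply: le_trans (_ : \sum_i (f i ^+ 2 * norm2 v ^+ 2) <= _).
  apply: ler_sum => i _; rewrite -expr2.
  have -> : (M *m v) i 0 = dot (row i M)^T v.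
    by rewrite dotE mxE; apply: eq_bigr => j _; rewrite !mxE.
  rewrite -exprMn -[leLHS]real_normK ?num_real//.
  rewrite ler_pXn2r ?nnegrE ?mulr_ge0 ?norm2_ge0// ler_norml cauchy_schwarz andbT.
  by rewrite lerNl -dotNr -(norm2N v) cauchy_schwarz.
rewrite -mulr_suml ler_wpM2r ?sqr_ge0// expr2 mulr_suml; apply: ler_sum => i _.
rewrite expr2 ler_wpM2l ?norm2_ge0// (bigD1 i)//= lerDl sumr_ge0// => j _.
exact: norm2_ge0.
Qed.

Lemma trace_opbound n (M : 'M[R]_n) k : 0 <= k -> opbound M k -> `|\tr M| <= n%:R * k.
Proof.
move=> k0 Mk; rewrite /mxtrace; apply: le_trans (ler_norm_sum _ _ _) _.
rewrite mulr_natl -[X in _ *+ X]card_ord -sumr_const; apply: ler_sum => i _.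
have e1 : norm2 (delta_mx i 0 : 'cV[R]_n) = 1.
  apply/eqP; rewrite -(@eqrXn2 _ 2) ?norm2_ge0// norm2_sqr expr1n dotE (bigD1 i)//=.
  rewrite !mxE !eqxx mulr1 big1 ?addr0// => j /negbTE ji.
  by rewrite !mxE ji mul0r.
have -> : M i i = dot (delta_mx i 0) (M *m delta_mx i 0).
  rewrite -colE dotE (bigD1 i)//= !mxE !eqxx mul1r big1 ?addr0// => j /negbTE ji.
  by rewrite !mxE ji mul0r.
have h := Mk (delta_mx i 0); rewrite e1 mulr1 in h.
rewrite ler_norml; apply/andP; split.
  rewrite lerNl -dotNr; apply: le_trans (cauchy_schwarz _ _) _.
  by rewrite norm2N e1 mul1r.
by apply: le_trans (cauchy_schwarz _ _) _; rewrite e1 mul1r.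
Qed.

Lemma dot_mulmx m n p (A : 'M[R]_(p, m)) (B : 'M[R]_(p, n)) u v :
  dot (A *m u) (B *m v) = dot u (A^T *m B *m v).
Proof. by rewrite -mulmxA [RHS]dot_mul trmxK. Qed.

End inner_product.

(** * The maximum singular value as an operator bound *)

Section spectral_norm.
Context {R : realType}.

(* If [T] is invertible and positive semidefinite, Cauchy-Schwarz for the form of
   [T], applied to [v] and [T^-1 v], gives
   [dot v v ^+ 2 <= dot v (T v) * dot v (T^-1 v)]. *)
Lemma psd_unit_coercive n (T : 'M[R]_n) : T^T = T ->
  (forall v, 0 <= dot v (T *m v)) -> T \in unitmx ->
  exists2 d, 0 < d & forall v, d * dot v v <= dot v (T *m v).
Proof.
move=> Tsym T0 Tu; have [k k0 Tk] := opbound_exists (invmx T).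
exists (k + 1)^-1; first by rewrite invr_gt0; lra.
move=> v; have := psd_cauchy_schwarz v (invmx T *m v) Tsym T0.
rewrite mulKVmx// (dotC (_ *m _)) => h.
have h2 : dot v (invmx T *m v) <= k * dot v v.
  apply: le_trans (cauchy_schwarz _ _) _; rewrite -norm2_sqr expr2 mulrCA.
  by rewrite ler_wpM2l ?norm2_ge0.
rewrite ler_pdivrMl; last by lra.
have := dot_ge0 v; rewrite le_eqVlt => /predU1P[<-|v0].
  by rewrite mulr_ge0// ltW//; lra.
rewrite -(ler_pM2l v0) -expr2; apply: le_trans h _.
have := T0 v; set b := dot v (T *m v); set q := dot v v in v0 h2 *.
move=> b0; have : b * dot v (invmx T *m v) <= b * (k * q) by rewrite ler_wpM2l.
have := mulr_ge0 b0 (ltW v0); nra.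
Qed.

Lemma gram_eigenvalue m n (M : 'M[R]_(m, n)) a :
  eigenvalue (M^T *m M) a -> exists2 v, v != 0 & dot (M *m v) (M *m v) = a * dot v v.
Proof.
move=> /eigenvalueP[u uM u0]; exists u^T; first by rewrite trmx_eq0.
have e : (M^T *m M) *m u^T = a *: u^T.
  have := congr1 (fun x => x^T) uM.
  by rewrite trmx_mul [(_ *m M)^T]trmx_mul trmxK linearZ.
by rewrite -dotZr -e -mulmxA [RHS]dot_mul trmxK.
Qed.

(** The supremum [s] of the Rayleigh quotient ||M w||^2 / ||w||^2 is itself an eigenvalue of M^T M,
    so its square root is one of the singular values. *)
Lemma max_singular_value_opbound m n (M : 'M[R]_(m, n)) :
  opbound M (max_singular_value M).
Proof.
have [k k0 Mk] := opbound_exists M.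
have MkE v : dot (M *m v) (M *m v) <= k ^+ 2 * dot v v.
  rewrite -!norm2_sqr -exprMn ler_pXn2r// ?nnegrE ?mulr_ge0 ?norm2_ge0//.
move=> v; have [v0|v0] := lerP (norm2 v) 0.
  by rewrite (norm2_le0 v0) mulmx0 !norm20 mulr0.
pose q w := dot (M *m w) (M *m w) / dot w w.
have qw w : w != 0 -> dot (M *m w) (M *m w) = q w * dot w w.
  by move=> w0; rewrite /q divfK//; apply: contra_neq w0; exact: dot_eq0.
have dw (w : 'cV[R]_n) : w != 0 -> 0 < dot w w.
  by move=> w0; rewrite lt_neqAle dot_ge0 andbT eq_sym; apply: contra_neq w0; exact: dot_eq0.
have vn0 : v != 0 by apply/eqP => vE; rewrite vE norm20 ltxx in v0.
pose A := [set q w | w in [set w | w != 0]].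
have Aub : has_sup A.
  split; first by exists (q v), v.
  exists (k ^+ 2) => _ [w w0 <-]; rewrite /q ler_pdivrMr ?dw//.
pose s := sup A.
have sA w : dot (M *m w) (M *m w) <= s * dot w w.
  have [->|w0] := eqVneq w 0; first by rewrite mulmx0 !dotE !big1 ?mulr0// => i _; rewrite !mxE mul0r.
  by rewrite qw// ler_pM2r ?dw//; apply: sup_upper_bound => //; exists w.
pose T : 'M[R]_n := s%:M - M^T *m M.
have TE w : dot w (T *m w) = s * dot w w - dot (M *m w) (M *m w).
  by rewrite mulmxBl dotDr dotNr mul_scalar_mx dotZr dot_mulmx.
have Tsym : T^T = T by rewrite /T linearB/= tr_scalar_mx trmx_mul trmxK.
have Tpsd w : 0 <= dot w (T *m w) by rewrite TE subr_ge0.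
have eig : eigenvalue (M^T *m M) s.
  suff : T \notin unitmx.
    rewrite -row_free_unit /eigenvalue /eigenspace kermx_eq0; apply: contra.
    move=> /row_freeP[X XE]; apply/row_freeP; exists (- X).
    by rewrite mulmxN -mulNmx opprB.
  (* An invertible [T] would be coercive with some d > 0, and no Rayleigh quotient could exceed s -
     d. *)
  apply/negP => Tu; have [d d0 dT] := psd_unit_coercive Tsym Tpsd Tu.
  have [_ [w w0 <-]] := sup_adherent d0 Aub; rewrite -/s => hq.
  have := dT w; rewrite TE qw// -mulrBl ler_pM2r ?dw//; lra.
have qs w : w != 0 -> 0 <= q w by move=> w0; rewrite divr_ge0 ?dot_ge0.
have s0 : 0 <= s by apply: le_trans (qs _ vn0) _; apply: sup_upper_bound => //; exists v.
have hS : has_sup [set Num.sqrt a | a in [set a | eigenvalue (M^T *m M) a]].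
  split; first by exists (Num.sqrt s), s.
  exists k => _ [a /= /gram_eigenvalue[w w0 e] <-].
  have -> : k = Num.sqrt (k ^+ 2) by rewrite sqrtr_sqr ger0_norm.
  by apply: ler_wsqrtr; rewrite -(ler_pM2r (dw _ w0)) -e MkE.
have : Num.sqrt s <= max_singular_value M by apply: sup_upper_bound => //; exists s.
move=> h; apply: le_trans (_ : Num.sqrt s * norm2 v <= _); last by rewrite ler_wpM2r ?norm2_ge0.
apply: norm2_le; first by rewrite mulr_ge0 ?sqrtr_ge0 ?norm2_ge0.
by rewrite exprMn sqr_sqrtr// norm2_sqr.
Qed.

End spectral_norm.

(** * Worst-case CVaR and quadratic majorants *)

Section moments.
Local Open Scope ereal_scope.

(* The library's [ge0_le_integral] needs measurable functions; the integral being
   a supremum over simple functions, monotonicity holds without it. *)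
Lemma le_integral_ge0 d (T : measurableType d) (R : realType)
    (mu : {measure set T -> \bar R}) (f g : T -> \bar R) :
  (forall x, 0 <= f x) -> (forall x, f x <= g x) ->
  \int[mu]_x f x <= \int[mu]_x g x.
Proof.
move=> f0 fg; have g0 x : 0 <= g x by apply: le_trans (fg x).
rewrite !ge0_integralTE//; apply: le_ereal_sup => _ [h /= hf <-].
by exists h => //= x; apply: le_trans (hf x) (fg x).
Qed.

Context {R : realType} {m : nat}.

Definition vec (v : m.-tuple R) : 'cV[R]_m := \col_k tnth v k.

Lemma moment_ambiguity_set_sym (W : 'M[R]_m) P : moment_ambiguity_set W P -> W^T = W.
Proof.
move=> [_ _ hcov]; apply/matrixP => k l; rewrite mxE.
by have := hcov k l; rewrite covarianceC hcov => -[].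
Qed.

(** As the means vanish, covariances are expectations of products of coordinates, and the quadratic
    form is a finite combination of these. *)
Lemma expectation_quadratic (W : 'M[R]_m) P : moment_ambiguity_set W P ->
  forall (q : R) (S : 'M[R]_m),
  'E_P[(fun v => q + dot (vec v) (S *m vec v))%R] = (q + \tr (S *m W))%:E.
Proof.
move=> hP q S; have Wsym := moment_ambiguity_set_sym hP.
case: hP => h2 hmean hcov; pose xi k := fun v : m.-tuple R => tnth v k.
have h11 : (P setT) \is a fin_num by rewrite probability_setT.
have h1 k : xi k \in Lfun P 1 by apply: Lfun_subset12 (h2 k).
have hp k l : (xi k \* xi l)%R \in Lfun P 1 by exact: Lfun2_mul_Lfun1 (h2 k) (h2 l).
have ep k l : 'E_P[(xi k \* xi l)%R] = (W k l)%:E.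
  by have := covarianceE (h1 k) (h1 l) (hp k l); rewrite hcov !hmean mule0 sube0 => ->.
have fE : (fun v => q + dot (vec v) (S *m vec v))%R =
    (fun v => q + \sum_(kl : 'I_m * 'I_m) xi kl.1 v * xi kl.2 v * S kl.1 kl.2)%R.
  apply/funext => v; congr (_ + _)%R; rewrite dotE.
  under eq_bigr do rewrite !mxE mulr_sumr.
  rewrite pair_big/=; apply: eq_bigr => -[k l] _; rewrite /xi /= !mxE; ring.
have hk (kl : 'I_m * 'I_m) : P.-integrable setT
    (fun v => (xi kl.1 v * xi kl.2 v * S kl.1 kl.2)%:E).
  by apply/Lfun1_integrable; apply: (Lfun_scale (S kl.1 kl.2) (lexx _) (hp kl.1 kl.2)).
rewrite fE unlock.
under eq_integral do rewrite EFinD -sumEFin.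
rewrite integralD//; last 2 first.
- by apply/Lfun1_integrable; exact: Lfun_cst.
- exact: integrable_sum.
rewrite integral_cst//= [X in _ * X](_ : _ = 1); last exact: probability_setT.
rewrite mule1 integral_sum// EFinD; congr (_ + _).
rewrite (_ : \tr (S *m W) = \sum_(kl : 'I_m * 'I_m) S kl.1 kl.2 * W kl.1 kl.2)%R.
  rewrite -sumEFin; apply: eq_bigr => kl _.
  have := @expectationZl _ _ _ P (xi kl.1 \* xi kl.2)%R (S kl.1 kl.2) (hp _ _).
  rewrite ep unlock -EFinM => <-; apply: eq_integral => v _ /=; congr EFin; ring.
rewrite /mxtrace; under eq_bigr do rewrite mxE.
rewrite pair_big/=; apply: eq_bigr => -[k l] _ /=.
by rewrite -{1}Wsym mxE.
Qed.

Lemma moment_ambiguity_set_trace_ge0 (W : 'M[R]_m) P : moment_ambiguity_set W P ->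
  forall n (A : 'M[R]_(n, m)), (0 <= \tr (A *m W *m A^T))%R.
Proof.
move=> hP n A; rewrite mxtrace_mulC mulmxA -[X in (0 <= X)%R]add0r -lee_fin.
rewrite -(expectation_quadratic hP) unlock; apply: integral_ge0 => v _.
by rewrite lee_fin add0r -dot_mulmx dot_ge0.
Qed.

(** A single [beta] bounds the infimum for every distribution, and the expectation of the quadratic
    majorant depends on [W] alone. The last hypothesis is asked only when a distribution exists, so
    that positivity of [W] can be used to prove it. *)
Lemma worst_case_CVaR_le0 (W : 'M[R]_m) (eps beta q : R) (L : m.-tuple R -> R) (S : 'M[R]_m) :
  (0 < eps)%R ->
  (forall v, Num.max (L v - beta) 0 <= q + dot (vec v) (S *m vec v))%R ->
  (forall P, moment_ambiguity_set W P -> beta + eps^-1 * (q + \tr (S *m W)) <= 0)%R ->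
  worst_case_CVaR (moment_ambiguity_set W) eps L <= 0.
Proof.
move=> eps0 hq hS; apply: ge_ereal_sup => _ [P hP <-].
apply: (@le_trans _ _ (beta%:E + eps^-1%:E * 'E_P[(fun xi => Num.max (L xi - beta) 0)%R])).
  by apply: ereal_inf_lbound; exists beta.
apply: (@le_trans _ _ (beta%:E + eps^-1%:E * (q + \tr (S *m W))%:E)).
  rewrite leeD2l// lee_wpmul2l//; first by rewrite lee_fin invr_ge0 ltW.
  rewrite -(expectation_quadratic hP).
  rewrite unlock. apply: le_integral_ge0 => v; first by rewrite lee_fin le_max lexx orbT.
  by rewrite lee_fin hq.
by rewrite -EFinM -EFinD lee_fin (hS P).
Qed.

End moments.

(** * Event-triggered trajectories *)

Section event_trigger.
Context {R : realType} {nx nu nw : nat}.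
Variables (A : 'M[R]_nx) (B : 'M[R]_(nx, nu)) (E : 'M[R]_(nx, nw)).
Variables (K : 'M[R]_(nu, nx)) (sigma2 : R).

Lemma trigger_time_next (x : nat -> 'cV[R]_nx) k tk : trigger_time K sigma2 x k = Some tk ->
  match trigger_time K sigma2 x k.+1 with
  | Some t => (tk < t)%N /\ forall s, (tk < s < t)%N -> norm2 (K *m (x tk - x s)) <= sigma2
  | None => forall s, (tk < s)%N -> norm2 (K *m (x tk - x s)) <= sigma2
  end.
Proof.
move=> hk; rewrite [trigger_time _ _ _ _]/= hk /=.
have := first_timeP (fun t => (tk < t)%N && (sigma2 < norm2 (K *m (x tk - x t)))).
case: first_time => [t [/andP[tkt _] h]|h].
  split=> // s /andP[tks st]; rewrite leNgt; apply/negP => c.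
  by have := h s; rewrite tks c => /(_ isT); rewrite leqNgt st.
by move=> s tks; have := h s; rewrite tks -leNgt.
Qed.

Lemma before_trigger_time_next (x : nat -> 'cV[R]_nx) k tk :
  trigger_time K sigma2 x k = Some tk -> before_time tk (trigger_time K sigma2 x k.+1).
Proof. by move/trigger_time_next; case: (trigger_time K sigma2 x k.+1) => //= s []. Qed.

(** The maximum with 0 covers the triggering times, where the error vanishes whatever the sign of
    [sigma2]. The last clause says that [xhat] is either held or reset. *)
Lemma trajectory_feedback x0 w x : event_triggered_trajectory A B E K sigma2 x0 w x ->
  exists xhat : nat -> 'cV[R]_nx,
  [/\ x 0%N = x0,
      forall t, x t.+1 = (A + B *m K) *m x t + B *m K *m (xhat t - x t) + E *m w t,
      forall t, norm2 (K *m (xhat t - x t)) <= Num.max sigma2 0 &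
      forall t, xhat t.+1 = xhat t \/ xhat t.+1 = x t.+1].
Proof.
move=> [u [xhat [x00 xS uE xhatE]]]; exists xhat.
have cover t : exists k tk, [/\ trigger_time K sigma2 x k = Some tk, (tk <= t)%N &
    before_time t (trigger_time K sigma2 x k.+1)].
  elim: t => [|t [k [tk [hk tkt bt]]]].
    by exists 0%N, 0%N; split=> //; exact: before_trigger_time_next.
  case e : (trigger_time K sigma2 x k.+1) (bt) => [t'|] bt'; last first.
    by exists k, tk; rewrite e; split=> //; exact: leqW.
  have : (t < t')%N := bt'; rewrite leq_eqVlt => /predU1P[t'E|tt'].
    exists k.+1, t'; split; [exact: e|by rewrite t'E|].
    by rewrite t'E; exact: before_trigger_time_next e.
  by exists k, tk; rewrite e; split=> //; exact: leqW.
split=> // t.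
- rewrite xS uE mulmxDl mulmxBr -!mulmxA; congr (_ + _).
  by rewrite -addrA; congr (_ + _); rewrite addrC subrK.
- have [k [tk [hk tkt bt]]] := cover t; rewrite (xhatE _ _ _ hk tkt bt).
  move: tkt; rewrite leq_eqVlt => /predU1P[->|tkt].
    by rewrite subrr mulmx0 norm20 le_max lexx orbT.
  rewrite le_max; apply/orP; left; have := trigger_time_next hk.
  move: bt; case: (trigger_time K sigma2 x k.+1) => /= [t' tt' [_ h]|_ h]; apply: h => //.
  by rewrite tkt.
- have [k [tk [hk tkt bt]]] := cover t; rewrite (xhatE _ _ _ hk tkt bt).
  have [b1|b1] := boolP (before_time t.+1 (trigger_time K sigma2 x k.+1)).
    by left; rewrite (xhatE _ _ _ hk _ b1)// leqW.
  right; case e : (trigger_time K sigma2 x k.+1) bt b1 => [t'|]//= tt'.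
  rewrite -leqNgt => t't; have t'E : t' = t.+1 by apply/eqP; rewrite eqn_leq t't.
  rewrite t'E in e; apply: (xhatE _ _ _ e) => //.
  exact: before_trigger_time_next e.
Qed.

End event_trigger.

(** * Response to the noise *)

Section noise_response.
Context {R : realType} {nx nw : nat}.
Variables (F : 'M[R]_nx) (E : 'M[R]_(nx, nw)) (Sigma_w : 'M[R]_nw) (P : 'M[R]_nx) (t : nat).

Definition block_proj (s : nat) : 'M[R]_(nw, t * nw) :=
  if insub s is Some s' then rowsub (fun i => mxtens_index (s' : 'I_t, i)) 1%:M else 0.

Lemma unstackE (v : (t * nw).-tuple R) s : unstack v s = block_proj s *m vec v.
Proof.
rewrite /unstack /block_proj; case: insubP => [s' _ _|_]; last by rewrite mul0mx.
by rewrite mul_rowsub_mx mul1mx; apply/colP => i; rewrite !mxE.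
Qed.

(** Realises each point of the sample space by a noise sequence, to which the hypothesis on
    trajectories applies. *)
Lemma stack_unstack (v : (t * nw).-tuple R) : stack (unstack v) t = v.
Proof.
apply: eq_from_tnth => k; rewrite tnth_mktuple.
case: (mxtens_indexP k) => s i; rewrite mxtens_indexK /= /unstack.
by rewrite insubT// => hs; rewrite mxE; congr (tnth v (mxtens_index (_, _))); apply: val_inj.
Qed.

Fixpoint noise_response (s : nat) : 'M[R]_(nx, t * nw) :=
  if s is s'.+1 then F *m noise_response s' + E *m block_proj s' else 0.

Let W := (1%:M : 'M[R]_t) *t Sigma_w.
Let Y := noise_response.
Hypothesis Sigma_sym : Sigma_w^T = Sigma_w.

Let Wsym : W^T = W. Proof. by rewrite /W trmx_tens trmx1 Sigma_sym. Qed.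

Lemma block_proj_cov s s' : (s < t)%N -> (s' < t)%N ->
  block_proj s *m W *m (block_proj s')^T = (s == s')%:R *: Sigma_w.
Proof.
move=> st s't; rewrite /block_proj !insubT mul_rowsub_mx mul1mx trmx_mxsub trmx1.
rewrite mulmx_colsub mulmx1; apply/matrixP => i j.
by rewrite mxE [in LHS]mxE tensmxE !mxE.
Qed.

(** y_s involves only the noise before time s, which is uncorrelated with w_s'. *)
Lemma noise_response_block s s' : (s <= s')%N -> (s' < t)%N ->
  Y s *m W *m (block_proj s')^T = 0.
Proof.
elim: s => [|s IH] ss' s't; first by rewrite !mul0mx.
rewrite /= !mulmxDl -!mulmxA !(mulmxA (noise_response s)) !(mulmxA (block_proj s)).
rewrite IH ?mulmx0 ?add0r//; last exact: ltnW.
by rewrite block_proj_cov// ?(ltn_trans ss')// ltn_eqF// scale0r mulmx0.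
Qed.

Hypothesis lyapunov : F *m P *m F^T - P + E *m Sigma_w *m E^T = 0.

(** By the Lyapunov equation the defect D_s = P - Var y_s satisfies D_(s+1) = F D_s F^T, and D_0 =
    P. *)
Lemma noise_response_var s : (s <= t)%N -> Y s *m W *m (Y s)^T = P - F ^+ s *m P *m (F ^+ s)^T.
Proof.
elim: s => [|s IH] st; first by rewrite !mul0mx expr0 trmx1 mulmx1 mul1mx subrr.
have YJ := noise_response_block (leqnn s) st.
have JY : block_proj s *m W *m (Y s)^T = 0.
  apply: trmx_inj; rewrite trmx0 -YJ !trmx_mul trmxK Wsym mulmxA; congr (_ *m _ *m _).
have -> : Y s.+1 *m W *m (Y s.+1)^T =
   F *m (Y s *m W *m (Y s)^T) *m F^T + F *m (Y s *m W *m (block_proj s)^T) *m E^T +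
   E *m (block_proj s *m W *m (Y s)^T) *m F^T +
   E *m (block_proj s *m W *m (block_proj s)^T) *m E^T.
  by rewrite /= linearD/= !trmx_mul !mulmxDl !mulmxDr !mulmxA !addrA addrAC -!addrA; do !congr (_ + _).
rewrite YJ JY !mulmx0 !mul0mx !addr0 block_proj_cov// eqxx scale1r IH; last exact: ltnW.
rewrite mulmxBr mulmxBl exprS -mulmxE trmx_mul !mulmxA.
rewrite addrAC; congr (_ - _).
by have := lyapunov; rewrite addrAC => /eqP; rewrite subr_eq0 => /eqP.
Qed.

(** The noise entering from time s on is uncorrelated with y_s, so each further step only multiplies
    by F^T. *)
Lemma noise_response_cov s k : (s + k <= t)%N ->
  Y s *m W *m (Y (s + k))^T = (P - F ^+ s *m P *m (F ^+ s)^T) *m (F ^+ k)^T.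
Proof.
elim: k => [|k IH] skt.
  by rewrite addn0 noise_response_var ?expr0 ?trmx1 ?mulmx1// -(addn0 s).
rewrite addnS /= linearD/= !trmx_mul mulmxDr !mulmxA IH; last by rewrite (leq_trans _ skt)// addnS.
rewrite noise_response_block ?leq_addr//; last by rewrite -addnS.
by rewrite mul0mx addr0 exprS -mulmxE trmx_mul mulmxA.
Qed.

End noise_response.

(** * Near-equality in the bound on the drift *)

Section near_tight.
Context {R : realType} {nx : nat}.
Variables (F : 'M[R]_nx) (a c : R).

Let V := a^-1 *: F^T.

Lemma scaled_adjoint_contraction : 0 < a -> opbound F a -> opbound V 1.
Proof.
move=> a0 Fa v; rewrite mul1r -scalemxAl norm2Z gtr0_norm ?invr_gt0// ler_pdivrMl//.
exact: opbound_tr (ltW a0) Fa v.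
Qed.

(** In ||z'||^2 = <F^T z', z> + <b, z'>, a norm of z' close to its upper bound makes both inner
    products nearly maximal; completed squares measure the defect. [s] bounds what is left of the
    initial state. *)
Lemma near_tight_step (s Delta : R) (z z' b : 'cV[R]_nx) :
  0 < a -> a < 1 -> 0 < c -> opbound F a -> 0 <= s ->
  norm2 z <= c + s -> norm2 b <= (1 - a) * c -> z' = F *m z + b ->
  c + s - norm2 z' <= Delta ->
  [/\ c + s - norm2 z <= Delta / a,
      norm2 (z - V *m z') ^+ 2 <= 2 * (c + s) * Delta / a &
      norm2 (b - (1 - a) *: z') ^+ 2 <= 2 * (c + s) * Delta].
Proof.
move=> a0 a1 c0 Fa s0 zc bc z'E hD.
have FT := opbound_tr (ltW a0) Fa z'.
have zF := Fa z; have zn := norm2_ge0 z; have z'n := norm2_ge0 z'.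
have bn := norm2_ge0 b; have FTn := norm2_ge0 (F^T *m z').
have tri : norm2 z' <= a * norm2 z + (1 - a) * c.
  by rewrite z'E; apply: le_trans (norm2D _ _) _; rewrite lerD.
have as_ : a * s <= s by rewrite ler_piMl// ltW.
have nc : norm2 z' <= c + s by have := ler_wpM2l (ltW a0) zc; lra.
have split_dot : norm2 z' ^+ 2 = dot (F^T *m z') z + dot b z'.
  by rewrite norm2_sqr {2}z'E dotDr dot_mul (dotC z' b).
set h1 := a *: z - F^T *m z'.
have e1 : norm2 h1 ^+ 2 = a ^+ 2 * norm2 z ^+ 2 - 2 * a * dot (F^T *m z') z
    + norm2 (F^T *m z') ^+ 2.
  rewrite !norm2_sqr !dot_expand (dotC z (F^T *m z')); ring.
set h2 := b - (1 - a) *: z'.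
have e2 : norm2 h2 ^+ 2 = norm2 b ^+ 2 - 2 * (1 - a) * dot b z'
    + (1 - a) ^+ 2 * norm2 z' ^+ 2.
  rewrite !norm2_sqr !dot_expand (dotC z' b); ring.
have hV : z - V *m z' = a^-1 *: h1.
  by rewrite /h1 scalerBr scalerA mulVf ?gt_eqF// scale1r -scalemxAl.
have sqr_le (u v : R) : 0 <= u -> u <= v -> u ^+ 2 <= v ^+ 2 by nra.
have b2 := sqr_le _ _ bn bc.
have z2 := sqr_le _ _ zn zc.
have F2 := sqr_le _ _ FTn FT.
(* The weights 1/a and 1/(1 - a) make the two bounds add up to at most (c + s)^2 - ||z'||^2. *)
have key : norm2 h1 ^+ 2 / a + norm2 h2 ^+ 2 / (1 - a) <= 2 * (c + s) * Delta.
  have k1 : norm2 h1 ^+ 2 / a <= a * (c + s) ^+ 2 - 2 * dot (F^T *m z') z + a * norm2 z' ^+ 2.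
    rewrite ler_pdivrMr// e1; rewrite exprMn in F2; have := ler_wpM2l (sqr_ge0 a) z2; lra.
  have k2 : norm2 h2 ^+ 2 / (1 - a) <= (1 - a) * c ^+ 2 - 2 * dot b z' + (1 - a) * norm2 z' ^+ 2.
    rewrite ler_pdivrMr ?subr_gt0// e2; rewrite exprMn in b2; lra.
  have : (1 - a) * c ^+ 2 <= (1 - a) * (c + s) ^+ 2.
    have c1 : 0 <= 1 - a by rewrite subr_ge0 ltW.
    have c2 : c ^+ 2 <= (c + s) ^+ 2 by apply: sqr_le; rewrite ?(ltW c0)// lerDl.
    exact: ler_wpM2l c1 _ _ c2.
  have : (c + s) ^+ 2 - norm2 z' ^+ 2 <= 2 * (c + s) * Delta by nra.
  lra.
have p1 : 0 <= norm2 h1 ^+ 2 / a by rewrite divr_ge0 ?sqr_ge0// ltW.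
have p2 : 0 <= norm2 h2 ^+ 2 / (1 - a) by rewrite divr_ge0 ?sqr_ge0// subr_ge0 ltW.
split.
- rewrite ler_pdivlMr//; nra.
- rewrite hV norm2Z exprMn gtr0_norm ?invr_gt0//.
  have -> : a^-1 ^+ 2 * norm2 h1 ^+ 2 = norm2 h1 ^+ 2 / a / a by rewrite expr2; ring.
  rewrite ler_wpM2r ?invr_ge0 ?(ltW a0)//; lra.
- have : norm2 h2 ^+ 2 / (1 - a) <= 2 * (c + s) * Delta by lra.
  rewrite ler_pdivrMr ?subr_gt0// => h; apply: le_trans h _.
  have X0 : 0 <= 2 * (c + s) * Delta by lra.
  by rewrite ler_piMr// lerBlDr lerDl ltW.
Qed.

(** M <= (M + 1)^2, which avoids square roots of constants. *)
Lemma le_linear_of_sqr (u M e : R) : 0 <= M -> 0 <= e -> u ^+ 2 <= M * e ^+ 2 ->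
  u <= (M + 1) * e.
Proof.
move=> M0 e0 h; have [u0|/ltW u0] := lerP u 0.
  by apply: le_trans u0 _; rewrite mulr_ge0// addr_ge0.
rewrite -(@ler_pXn2r _ 2)// ?nnegrE ?mulr_ge0 ?addr_ge0//.
apply: le_trans h _; rewrite exprMn ler_wpM2r ?sqr_ge0//; nra.
Qed.

(* The sequences run backwards in time: [zr k] and [br k] stand for [z (t - k)] and
   [b (t - k - 1)]. *)
Lemma near_tight_chain (D0 : R) N :
  0 < a -> a < 1 -> 0 < c -> opbound F a -> 0 <= D0 -> exists2 C, 0 <= C &
  forall e s (zr br : nat -> 'cV[R]_nx), 0 < e -> 0 <= s <= 1 ->
  (forall k, (k <= N)%N -> norm2 (zr k) <= c + s) ->
  (forall k, (k < N)%N -> zr k = F *m zr k.+1 + br k /\ norm2 (br k) <= (1 - a) * c) ->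
  c + s - norm2 (zr 0%N) <= D0 * e ^+ 2 ->
  (forall k, (k <= N)%N -> norm2 (zr k - V ^+ k *m zr 0%N) <= C * e /\
                           c + s - norm2 (zr k) <= C * e ^+ 2) /\
  (forall k, (k < N)%N -> norm2 (br k - (1 - a) *: (V ^+ k *m zr 0%N)) <= C * e).
Proof.
move=> a0 a1 c0 Fa D00; elim: N => [|N [C C0 IH]].
  exists D0 => // e s zr br e0 s01 hz hb h; split=> // k; rewrite leqn0 => /eqP ->.
  by rewrite expr0 mul1mx subrr norm20 mulr_ge0// ltW.
pose M := 2 * (c + 1) * C / a.
have M0 : 0 <= M by rewrite /M !mulr_ge0// ?invr_ge0; lra.
have Ca : C <= C / a by rewrite ler_pdivlMr// ler_piMr// ltW.
exists (C / a + M + 1 + C); first by rewrite !addr_ge0// divr_ge0// ltW.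
move=> e s zr br e0 /andP[s0 s1] hz hb h.
have [|h1 h2] := IH e s zr br e0 _ (fun k kN => hz k (leqW kN)) (fun k kN => hb k (leqW kN)) h.
  by rewrite s0.
have e20 := sqr_ge0 e.
have [b1 b2] := hb N (leqnn _).
have [h3 h4] := h1 N (leqnn _).
have [k1 k2 k3] := near_tight_step a0 a1 c0 Fa s0 (hz N.+1 (leqnn _)) b2 b1 h4.
have MC : 2 * (c + s) * (C * e ^+ 2) <= 2 * (c + 1) * C * e ^+ 2.
  by rewrite mulrA ler_wpM2r// ler_wpM2r//; lra.
have MM : 2 * (c + 1) * C * e ^+ 2 <= M * e ^+ 2.
  rewrite ler_wpM2r// /M ler_pdivlMr// ler_piMr ?(ltW a1)// !mulr_ge0//; lra.
have k2' : norm2 (zr N.+1 - V *m zr N) <= (M + 1) * e.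
  apply: le_linear_of_sqr; rewrite ?(ltW e0)//; apply: le_trans k2 _.
  rewrite /M [leRHS]mulrAC ler_wpM2r// invr_ge0 ltW//.
have k3' : norm2 (br N - (1 - a) *: zr N) <= (M + 1) * e.
  by apply: le_linear_of_sqr; rewrite ?(ltW e0)//; lra.
have Ce : 0 <= C / a * e by rewrite mulr_ge0 ?divr_ge0// ltW.
have Me : 0 <= (M + 1) * e by rewrite mulr_ge0 ?addr_ge0// ltW.
split=> k; rewrite ?ltnS leq_eqVlt => /predU1P[->|kN].
- split.
    (* Split off the newest error; V is a contraction, so the earlier ones are not amplified. *)
    rewrite exprS -mulmxE -mulmxA (_ : _ - _ = (zr N.+1 - V *m zr N) + V *m (zr N - V ^+ N *m zr 0%N)).
      apply: le_trans (norm2D _ _) _.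
      have := scaled_adjoint_contraction a0 Fa (zr N - V ^+ N *m zr 0%N); rewrite mul1r.
      by move=> ?; nra.
    by rewrite mulmxBr addrA subrK.
  have : C * e ^+ 2 / a = C / a * e ^+ 2 by rewrite mulrAC.
  have : 0 <= (M + 1 + C) * e ^+ 2 by rewrite mulr_ge0// !addr_ge0.
  lra.
- have [h5 h6] := h1 k kN; split; first nra.
  have : 0 <= (C / a + M + 1) * e ^+ 2 by rewrite mulr_ge0// !addr_ge0// divr_ge0// ltW.
  lra.
- rewrite (_ : _ - _ = (br N - (1 - a) *: zr N) + (1 - a) *: (zr N - V ^+ N *m zr 0%N)).
    apply: le_trans (norm2D _ _) _; rewrite norm2Z ger0_norm; last by rewrite subr_ge0 ltW.
    have : (1 - a) * norm2 (zr N - V ^+ N *m zr 0%N) <= norm2 (zr N - V ^+ N *m zr 0%N).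
      by rewrite ler_piMl ?norm2_ge0//; lra.
    nra.
  by rewrite scalerBr addrA subrK.
- have := h2 k kN; nra.
Qed.

End near_tight.

(** * Splitting the state into drift and noise response *)

Section decomposition.
Context {R : realType} {nx : nat}.
Variables (F Q : 'M[R]_nx) (a c sp : R) (x0 : 'cV[R]_nx).

(* [z + y] is the state and [y] the response to the noise alone, so that [z] is
   driven by the triggering error only. *)
Definition decomposed (z y xhat : nat -> 'cV[R]_nx) : Prop :=
  [/\ z 0%N = x0,
      forall t, z t.+1 = F *m z t + Q *m (xhat t - (z t + y t)),
      forall t, norm2 (Q *m (xhat t - (z t + y t))) <= (1 - a) * c &
      forall t, xhat t.+1 = xhat t \/ xhat t.+1 = z t.+1 + y t.+1].

Definition gap (z y : 'cV[R]_nx) : R :=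
  (c + sp) * c + (c + sp) / sp * dot y y - dot (z + y) (z + y).

Lemma gapE z y : 0 < c -> 0 < sp ->
  gap z y = (c + sp) / c * (c ^+ 2 - dot z z)
          + c / sp * dot ((sp / c) *: z - y) ((sp / c) *: z - y).
Proof.
move=> c0 sp0; rewrite /gap !dot_expand (dotC y z).
by field; rewrite !gt_eqF.
Qed.

(** The right side solves n(t+1) = a n(t) + (1 - a) c with n(0) = ||x0||. *)
Lemma decomposed_bound z y xhat t : 0 <= a -> opbound F a -> decomposed z y xhat ->
  norm2 (z t) <= c + a ^+ t * norm2 x0 - a ^+ t * c.
Proof.
move=> a0 Fa [z0 zS hb _]; elim: t => [|t IH]; first by rewrite z0 expr0; lra.
rewrite zS exprS; apply: le_trans (norm2D _ _) _.
have := hb t; have := Fa (z t); have := ler_wpM2l a0 IH; lra.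
Qed.

Let V := a^-1 *: F^T.

(** The first term of [gapE] is at least of order -e^2, since the transient is at most e^2. Hence a
    gap below e^2 makes c - ||z_t|| at most of order e^2 and (sp / c) z_t - y_t of order e, and
    [near_tight_chain] runs backwards from t. *)
Lemma near_tight_decomposed N : 0 < a -> a < 1 -> 0 < c -> 0 < sp -> opbound F a ->
  exists2 C, 0 <= C & forall e t z y xhat, 0 < e <= 1 -> (N <= t)%N ->
  decomposed z y xhat -> a ^+ (t - N) * norm2 x0 <= e ^+ 2 -> gap (z t) (y t) <= e ^+ 2 ->
  [/\ norm2 ((sp / c) *: z t - y t) <= C * e,
      forall k, (k <= N)%N -> norm2 (z (t - k)%N - V ^+ k *m z t) <= C * e /\
                              c - norm2 (z (t - k)%N) <= C * e &
      forall k, (k < N)%N ->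
        norm2 (Q *m (xhat (t - k.+1)%N - (z (t - k.+1)%N + y (t - k.+1)%N))
               - (1 - a) *: (V ^+ k *m z t)) <= C * e].
Proof.
move=> a0 a1 c0 sp0 Fa.
pose r := c + sp; have r0 : 0 < r by rewrite addr_gt0.
have D00 : 0 <= r^-1 + 1 by rewrite addr_ge0// invr_ge0 ltW.
have [C C0 hC] := near_tight_chain N a0 a1 c0 Fa D00.
pose M := sp / c * (1 + r / c * (2 * c + 1)).
have M0 : 0 <= M.
  by rewrite !(mulr_ge0, addr_ge0, invr_ge0)// ltW.
exists (C + (M + 1)); first by rewrite !addr_ge0.
move=> e t z y xhat /andP[e0 e1] Nt dec hs hgap.
have e2 : 0 <= e ^+ 2 by exact: sqr_ge0.
have ee : e ^+ 2 <= e by rewrite expr2 ler_piMr// ltW.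
pose s := a ^+ (t - N) * norm2 x0.
rewrite -/s in hs.
have s0 : 0 <= s by rewrite mulr_ge0 ?exprn_ge0 ?norm2_ge0// ltW.
have hz k : (k <= N)%N -> norm2 (z (t - k)%N) <= c + s.
  move=> kN; apply: le_trans (decomposed_bound (t - k) (ltW a0) Fa dec) _.
  have : a ^+ (t - k) * norm2 x0 <= s.
    rewrite ler_wpM2r ?norm2_ge0// ler_wiXn2l ?(ltW a0) ?(ltW a1)//.
    by rewrite leq_sub2l.
  have : 0 <= a ^+ (t - k) * c by rewrite mulr_ge0 ?exprn_ge0// ltW.
  lra.
have hn := norm2_ge0 (z t).
have gE := gapE (z t) (y t) c0 sp0; rewrite -norm2_sqr -/r in gE.
have hh := dot_ge0 ((sp / c) *: z t - y t); set h := dot _ _ in hh gE.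
have hph : 0 <= c / sp * h by rewrite mulr_ge0// divr_ge0// ltW.
have hD : c + s - norm2 (z t) <= (r^-1 + 1) * e ^+ 2.
  suff : c - norm2 (z t) <= r^-1 * e ^+ 2 by lra.
  have [nc|nc] := lerP (norm2 (z t)) c; last first.
    by have : 0 <= r^-1 * e ^+ 2 by [rewrite mulr_ge0// invr_ge0 ltW]; lra.
  have : r / c * (c ^+ 2 - norm2 (z t) ^+ 2) <= e ^+ 2 by lra.
  rewrite mulrAC ler_pdivrMr// => h1.
  rewrite mulrC ler_pdivlMr// -(ler_pM2r c0); apply: le_trans h1.
  have : 0 <= r * ((c - norm2 (z t)) * norm2 (z t)).
    by rewrite !mulr_ge0// ?subr_ge0// ltW.
  lra.
have [||k kN||h1 h2] := hC e s (fun k => z (t - k)%N) (fun k => Q *m (xhat (t - k.+1)%N - (z (t - k.+1)%N + y (t - k.+1)%N))) e0.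
- by rewrite s0; lra.
- exact: hz.
- case: dec => _ zS hb _; split=> //=.
  have -> : (t - k = (t - k.+1).+1)%N by rewrite -subSn ?subSS// (leq_trans kN).
  by rewrite zS.
- by rewrite subn0.
rewrite !subn0 in h1 h2.
have Me : 0 <= (M + 1) * e by rewrite mulr_ge0 ?addr_ge0// ltW.
have Ce := mulr_ge0 C0 (ltW e0).
split.
- suff : norm2 ((sp / c) *: z t - y t) <= (M + 1) * e by lra.
  apply: le_linear_of_sqr; rewrite ?(ltW e0)// norm2_sqr -/h.
  have n2 : norm2 (z t) ^+ 2 - c ^+ 2 <= (2 * c + 1) * e ^+ 2.
    have := hz 0%N isT; rewrite subn0 => hz0; nra.
  have n3 : r / c * (norm2 (z t) ^+ 2 - c ^+ 2) <= r / c * ((2 * c + 1) * e ^+ 2).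
    by rewrite ler_wpM2l// divr_ge0// ltW.
  have h3 : c / sp * h <= e ^+ 2 + r / c * ((2 * c + 1) * e ^+ 2) by lra.
  have -> : h = sp / c * (c / sp * h) by field; rewrite !gt_eqF.
  have := ler_wpM2l (divr_ge0 (ltW sp0) (ltW c0)) h3; rewrite /M; lra.
- move=> k kN; have [h3 h4] := h1 k kN; split; first lra.
  have := ler_wpM2l C0 ee; lra.
- move=> k kN; have := h2 k kN; lra.
Qed.

End decomposition.

Lemma geometric_eventually_le (R : realType) (a D d : R) : 0 <= a -> a < 1 -> 0 < d ->
  exists T, forall t, (T <= t)%N -> a ^+ t * D <= d.
Proof.
move=> a0 a1 d0; have D1 : 0 < `|D| + 1 by rewrite ltr_wpDl.
have /cvgr0Pnorm_le h : (fun n => a ^+ n) @ \oo --> (0 : R).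
  by apply: cvg_expr; rewrite ger0_norm.
have dD : 0 < d / (`|D| + 1) by rewrite divr_gt0.
have [T _ hT] := h _ dD; exists T => t /hT /=.
rewrite ger0_norm ?exprn_ge0// ler_pdivlMr// => ht; apply: le_trans ht.
by rewrite ler_wpM2l ?exprn_ge0// (le_trans (ler_norm _))// lerDl.
Qed.

(** * Approximate linear relations on the noise at a small gap *)

Section tight_relations.
Context {R : realType} {nx : nat}.
Variables (F Q : 'M[R]_nx) (a c sp : R) (x0 : 'cV[R]_nx).

(* The linear relation [X0 y_t + X1 (y_(t-j-1) - y_(t-j-2)) = 0] holds
   approximately whenever [gap] almost vanishes at time [t]. *)
Definition tight_relation (X0 X1 : 'M[R]_nx) (j : nat) : Prop :=
  forall tau : R, 0 < tau -> exists e T, [/\ 0 < e <= 1, (j.+2 <= T)%N &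
    forall t z y xhat, (T <= t)%N -> decomposed F Q a c x0 z y xhat ->
    gap c sp (z t) (y t) <= e ->
    norm2 (X0 *m y t + X1 *m (y (t - j.+1)%N - y (t - j.+2)%N)) <= tau].

(** A linear rate suffices: take e with C e <= tau, let e^2 be the threshold for the gap, and T so
    late that the transient at time t - j - 2 is below e^2. *)
Lemma tight_relation_linear X0 X1 j C e0 : 0 <= a -> a < 1 -> 0 <= C -> 0 < e0 ->
  (forall e t z y xhat, 0 < e <= 1 -> e <= e0 -> (j.+2 <= t)%N ->
    decomposed F Q a c x0 z y xhat ->
    a ^+ (t - j.+2) * norm2 x0 <= e ^+ 2 -> gap c sp (z t) (y t) <= e ^+ 2 ->
    norm2 (X0 *m y t + X1 *m (y (t - j.+1)%N - y (t - j.+2)%N)) <= C * e) ->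
  tight_relation X0 X1 j.
Proof.
move=> a0 a1 C0 e00 h tau tau0.
have C1 : 0 < C + 1 by rewrite ltr_wpDl.
pose e := Num.min (Num.min 1 e0) (tau / (C + 1)).
have e_gt0 : 0 < e by rewrite !lt_min ltr01 e00 divr_gt0.
have e1 : e <= 1 by rewrite !ge_min lexx.
have [T hT] := geometric_eventually_le (norm2 x0) a0 a1 (exprn_gt0 2 e_gt0).
exists (e ^+ 2), (T + j.+2)%N; split; last first.
- move=> t z y xhat Tt dec hgap; apply: le_trans (h e t z y xhat _ _ _ dec _ hgap) _.
  + by rewrite e_gt0.
  + by rewrite !ge_min lexx orbT.
  + exact: leq_trans (leq_addl _ _) Tt.
  + by apply: hT; rewrite leq_subRL ?(leq_trans (leq_addl _ _) Tt)// addnC.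
  + have : e <= tau / (C + 1) by rewrite ge_min lexx orbT.
    rewrite ler_pdivlMr// => he; lra.
- exact: leq_addl.
- by rewrite exprn_gt0// exprn_ile1// ltW.
Qed.

Let V := a^-1 *: F^T.

(** As F = a V^T, inserting z_(t-1) ~ V z_t and b_(t-1) ~ (1 - a) z_t into z_t = F z_(t-1) + b_(t-1)
    gives V^T V z_t ~ z_t; finally y_t ~ (sp / c) z_t. *)
Lemma tight_relation_isometry : 0 < a -> a < 1 -> 0 < c -> 0 < sp -> opbound F a ->
  tight_relation (1%:M - V^T *m V) 0 0.
Proof.
move=> a0 a1 c0 sp0 Fa; set X0 := 1%:M - _.
have [C C0 hC] := near_tight_decomposed Q x0 2 a0 a1 c0 sp0 Fa.
have [k k0 Xk] := opbound_exists X0.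
have th0 : 0 <= sp / c by rewrite divr_ge0// ltW.
have V0 := opbound_tr ler01 (scaled_adjoint_contraction a0 Fa).
apply: (@tight_relation_linear _ _ _ (sp / c * (1 + a^-1) * C + k * C) 1) => //.
- exact: ltW.
- have ai : 0 <= a^-1 by rewrite invr_ge0 ltW.
  by rewrite addr_ge0// mulr_ge0// mulr_ge0// addr_ge0.
move=> e t z y xhat e01 _ t2 dec hs hgap.
have [h1 h2 h3] := hC e t z y xhat e01 t2 dec hs hgap.
rewrite mul0mx addr0; have [h4 _] := h2 1%N isT; have h5 := h3 0%N isT.
rewrite expr1 in h4; rewrite expr0 mul1mx in h5.
set b := Q *m _ in h5.
have zE : z t = F *m z (t - 1)%N + b.
  by case: dec => _ zS _ _; rewrite /b -zS; congr z; rewrite subn1 prednK// (leq_trans _ t2).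
have XE : X0 *m z t = V^T *m (z (t - 1)%N - V *m z t) + a^-1 *: (b - (1 - a) *: z t).
  have VF : V^T *m z (t - 1)%N = a^-1 *: (z t - b).
    by rewrite /V linearZ/= trmxK -scalemxAl zE addrK.
  rewrite /X0 mulmxBl mul1mx mulmxBr VF mulmxA; apply/colP => i; rewrite !mxE; field.
  by rewrite gt_eqF.
rewrite (_ : X0 *m y t = (sp / c) *: (X0 *m z t) - X0 *m ((sp / c) *: z t - y t)); last first.
  by rewrite mulmxBr -scalemxAr opprB addrC subrK.
have n1 : norm2 (X0 *m z t) <= C * e + a^-1 * (C * e).
  rewrite XE; apply: le_trans (norm2D _ _) _; apply: lerD.
    by apply: le_trans (V0 _) _; rewrite mul1r.
  by rewrite norm2Z gtr0_norm ?invr_gt0// ler_wpM2l// invr_ge0 ltW.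
apply: le_trans (norm2B _ _) _; rewrite norm2Z ger0_norm//.
have := ler_wpM2l th0 n1; have := Xk ((sp / c) *: z t - y t); have := ler_wpM2l k0 h1.
lra.
Qed.

(** Without triggering, [xhat] cancels in b_(t-j-2) - b_(t-j-1) = Q (x_(t-j-1) - x_(t-j-2)).
    Approximating b and z through z_t, and z_t by (c / sp) y_t, leaves a relation on the noise
    response. *)
Lemma tight_relation_no_trigger j : 0 < a -> a < 1 -> 0 < c -> 0 < sp -> opbound F a ->
  tight_relation ((c / sp) *: (((1 - a)%:M + Q *m V) *m (V ^+ j - V ^+ j.+1))) Q j.
Proof.
move=> a0 a1 c0 sp0 Fa; set X0 := _ *: _.
have [C C0 hC] := near_tight_decomposed Q x0 j.+2 a0 a1 c0 sp0 Fa.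
have [k k0 Xk] := opbound_exists X0.
have [q q0 Qq] := opbound_exists Q.
have ac0 : 0 < (1 - a) * c by rewrite mulr_gt0// subr_gt0.
apply: (@tight_relation_linear _ _ _ (k * C + 2 * C + 2 * q * C) ((1 - a) * c / 2 / (3 * C + 1))) => //.
- exact: ltW.
- by rewrite !(addr_ge0, mulr_ge0).
- by rewrite !divr_gt0//; lra.
move=> e t z y xhat e01 ee0 t2 dec hs hgap.
have [h1 h2 h3] := hC e t z y xhat e01 t2 dec hs hgap.
have [hz1 _] := h2 j.+1 (leqnSn _); have [hz2 _] := h2 j.+2 (leqnn _).
have hb1 := h3 j (leqnSn _); have hb2 := h3 j.+1 (leqnn _).
set bA := Q *m _ in hb1; set bB := Q *m _ in hb2.
have tE : (t - j.+1 = (t - j.+2).+1)%N by rewrite -subSn ?subSS.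
have [hx|hx] : xhat (t - j.+1)%N = xhat (t - j.+2)%N \/
               xhat (t - j.+1)%N = z (t - j.+1)%N + y (t - j.+1)%N.
- by rewrite tE; case: dec.
- have -> : X0 *m y t + Q *m (y (t - j.+1)%N - y (t - j.+2)%N) =
      (((bB - (1 - a) *: (V ^+ j.+1 *m z t)) - (bA - (1 - a) *: (V ^+ j *m z t))) +
       Q *m ((z (t - j.+2)%N - V ^+ j.+2 *m z t) - (z (t - j.+1)%N - V ^+ j.+1 *m z t))) -
      X0 *m ((sp / c) *: z t - y t).
    have XE : X0 *m ((sp / c) *: z t) = (1 - a) *: (V ^+ j *m z t) - (1 - a) *: (V ^+ j.+1 *m z t)
        + Q *m (V ^+ j.+1 *m z t) - Q *m (V ^+ j.+2 *m z t).
      rewrite /X0 -scalemxAr -scalemxAl scalerA mulf_div [X in X / _]mulrC divff ?mulf_neq0 ?gt_eqF//.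
      have VS i : V *m (V ^+ i *m z t) = V ^+ i.+1 *m z t by rewrite mulmxA mulmxE -exprS.
      rewrite scale1r -mulmxA mulmxBl mulmxDl -mulmxA [V *m _]mulmxBr !VS.
      by rewrite mul_scalar_mx scalerBr mulmxBr addrA.
    rewrite [X in _ = _ - X]mulmxBr XE /bA /bB hx !(mulmxDr, mulmxN).
    by apply/colP => i; rewrite !mxE; ring.
  have n1 : norm2 (Q *m ((z (t - j.+2)%N - V ^+ j.+2 *m z t) - (z (t - j.+1)%N - V ^+ j.+1 *m z t)))
      <= q * (2 * (C * e)).
    apply: le_trans (Qq _) _; rewrite ler_wpM2l//.
    by apply: le_trans (norm2B _ _) _; lra.
  have n2 := le_trans (Xk ((sp / c) *: z t - y t)) (ler_wpM2l k0 h1).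
  apply: le_trans (norm2B _ _) _.
  have := norm2D ((bB - (1 - a) *: (V ^+ j.+1 *m z t)) - (bA - (1 - a) *: (V ^+ j *m z t))) (Q *m ((z (t - j.+2)%N - V ^+ j.+2 *m z t) - (z (t - j.+1)%N - V ^+ j.+1 *m z t))).
  have := norm2B (bB - (1 - a) *: (V ^+ j.+1 *m z t)) (bA - (1 - a) *: (V ^+ j *m z t)).
  lra.
(* A reset makes b_(t-j-1) = 0, although it is within C e of (1 - a) V^j z_t, whose norm is at least
   (1 - a) (c - 2 C e). The bound imposed on e gives 3 C e < (1 - a) c and excludes this. *)
- exfalso; move: hb1; rewrite /bA hx subrr mulmx0 sub0r norm2N norm2Z gtr0_norm ?subr_gt0//.
  have [h4 h5] := h2 j (ltnW (leqnSn _)).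
  have := norm2D (z (t - j)%N - V ^+ j *m z t) (V ^+ j *m z t); rewrite subrK.
  move=> h6 h7; have a1' : 0 <= 1 - a by rewrite subr_ge0 ltW.
  have h8 : c - 2 * (C * e) <= norm2 (V ^+ j *m z t) by lra.
  have := ler_wpM2l a1' h8.
  have e0 : 0 < e by case/andP: e01.
  have Ce : 0 <= C * e by rewrite mulr_ge0// ltW.
  have : a * (C * e) >= 0 by rewrite mulr_ge0// ltW.
  have C31 : 0 < 3 * C + 1 by lra.
  move: ee0; rewrite ler_pdivlMr// => *; lra.
Qed.

End tight_relations.

(** * The dual certificate *)

Section certificate.
Context {R : realType} {nx : nat}.
Variables (c sp : R).
Hypotheses (c0 : 0 < c) (sp0 : 0 < sp).

Lemma norm2_sqr_le_gap Z (z y : 'cV[R]_nx) : norm2 z <= Z ->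
  dot y y <= 2 * (sp / c) * gap c sp z y
             + (2 * (sp / c) ^+ 2 + 2 * (sp / c) * ((c + sp) / c)) * Z ^+ 2.
Proof.
move=> zZ; set h := (sp / c) *: z - y.
have yE : y = (sp / c) *: z - h by rewrite /h opprB addrC subrK.
have gE : c / sp * dot h h = gap c sp z y - (c + sp) / c * (c ^+ 2 - dot z z).
  by rewrite gapE// -/h addrAC subrr add0r.
have hE : dot h h = sp / c * gap c sp z y - sp / c * ((c + sp) / c) * (c ^+ 2 - dot z z).
  have -> : dot h h = sp / c * (c / sp * dot h h) by field; rewrite !gt_eqF.
  by rewrite gE; ring.
have y2 : dot y y <= 2 * (sp / c) ^+ 2 * dot z z + 2 * dot h h.
  have aux (u v : 'cV[R]_nx) : dot (u - v) (u - v) <= 2 * dot u u + 2 * dot v v.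
    by have := dot_ge0 (u + v); rewrite !dot_expand (dotC v u); lra.
  by have := aux ((sp / c) *: z) h; rewrite -yE dotZr dotZl; lra.
have z2 : dot z z <= Z ^+ 2.
  by have := norm2_ge0 z; rewrite -norm2_sqr; nra.
have th : 0 <= sp / c by rewrite divr_ge0// ltW.
have k1 : 0 <= sp / c * ((c + sp) / c) by rewrite mulr_ge0// divr_ge0 ?addr_ge0// ltW.
have k2 : 0 <= sp / c * ((c + sp) / c) * c ^+ 2 by rewrite mulr_ge0 ?sqr_ge0.
have := ler_wpM2l k1 z2; have := ler_wpM2l (sqr_ge0 (sp / c)) z2; lra.
Qed.

(* For small [lambda] the quadratic on the right dominates the loss: its
   perturbation of [(c + sp) / sp * dot y y] is at least [- lambda * C * dot y y],
   which [gap] absorbs away from its zeros, while near the zeros of [gap] it is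
   small because [l] is. *)
Lemma quadratic_certificate (N : 'M[R]_nx) (nu mu Z : R) : 0 < nu -> 0 < mu ->
  exists2 tau, 0 < tau & forall e, 0 < e <= 1 ->
  exists2 lambda, 0 < lambda & forall z y l : 'cV[R]_nx, norm2 z <= Z ->
  (gap c sp z y <= e -> norm2 l <= tau) -> - (lambda * nu / 2) <= gap c sp z y ->
  Num.max (dot (z + y) (z + y) - (c + sp) * c) 0 <=
    lambda * nu + ((c + sp) / sp * dot y y + lambda * (mu * dot l l - 2 * dot (N *m y) l)).
Proof.
move: c0 sp0 => C_gt0 SP0 nu0 mu0; have [k k0 Nk] := opbound_exists N.
pose th := sp / c; have th0 : 0 <= th by rewrite divr_ge0// ltW.
pose rc := (c + sp) / c; have rc0 : 0 <= rc by rewrite divr_ge0// ?addr_ge0// ltW.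
pose C2 := (2 * th ^+ 2 + 2 * th * rc) * Z ^+ 2.
have C20 : 0 <= C2.
  by apply: mulr_ge0 (sqr_ge0 _); have := sqr_ge0 th; have := mulr_ge0 th0 rc0; lra.
(* Completing the square: mu ||l||^2 - 2 k ||y|| ||l|| >= - C1 ||y||^2. *)
pose C1 := k ^+ 2 / mu; have C10 : 0 <= C1 by rewrite divr_ge0 ?sqr_ge0// ltW.
pose Y2 := 2 * th + C2 + 1; have Y20 : 1 <= Y2 by rewrite /Y2; lra.
(* [Y2] bounds ||y||^2 for a gap below 1, hence also ||y|| as [Y2] >= 1; this [tau] then keeps 2 k
   ||y|| ||l|| within nu / 2. *)
pose tau := nu / (4 * (k + 1) * Y2).
have den0 : 0 < 4 * (k + 1) * Y2 by rewrite !mulr_gt0//; lra.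
exists tau; first by rewrite divr_gt0.
move=> e /andP[e0 e1].
pose rs := (c + sp) / sp; have rs0 : 0 < rs by rewrite divr_gt0// addr_gt0.
(* With lambda = 1 / [den], the last three summands give lambda C1 <= rs, 4 lambda th C1 <= 1 and 2
   lambda C1 C2 <= e. *)
pose den := 1 + C1 / rs + 4 * th * C1 + 2 * C1 * C2 / e.
have q1 : 0 <= C1 / rs by rewrite divr_ge0// ltW.
have q2 : 0 <= 4 * th * C1 by have := mulr_ge0 th0 C10; lra.
have q3 : 0 <= 2 * C1 * C2 / e.
  by apply: divr_ge0 (ltW e0); have := mulr_ge0 C10 C20; lra.
have den_gt0 : 0 < den by rewrite /den; lra.
have lam0 : 0 < den^-1 by rewrite invr_gt0.
exists den^-1 => //; set lam := den^-1 in lam0 *.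
have lamden : lam * den = 1 by rewrite mulVf// gt_eqF.
have lam_le1 u v : 0 < v -> u / v <= den -> lam * u <= v.
  move=> v0 h; have := ler_wpM2l (ltW lam0) h.
  by rewrite lamden mulrA ler_pdivrMr// mul1r.
have l1 : lam * C1 <= rs by apply: lam_le1 => //; rewrite /den; lra.
have l2 : lam * (4 * th * C1) <= 1 by apply: lam_le1; rewrite ?divr1// /den; lra.
have l3 : lam * (2 * C1 * C2) <= e by apply: lam_le1 => //; rewrite /den; lra.
move=> z y l zZ small gapd.
have gapE' : gap c sp z y = (c + sp) * c + rs * dot y y - dot (z + y) (z + y) by [].
have y2 := norm2_sqr_le_gap y zZ; rewrite -/th -/rc -/C2 in y2.
set g := gap c sp z y in small gapd gapE' y2.
have yy0 := dot_ge0 y; have ll0 := dot_ge0 l.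
have yn := norm2_ge0 y; have ln := norm2_ge0 l.
have Nyl : dot (N *m y) l <= k * norm2 y * norm2 l.
  by apply: le_trans (cauchy_schwarz _ _) _; rewrite ler_wpM2r.
have pert : - (C1 * dot y y) <= mu * dot l l - 2 * dot (N *m y) l.
  rewrite -!norm2_sqr /C1 in yy0 ll0 *.
  have : 0 <= mu * (norm2 l - k * norm2 y / mu) ^+ 2 by rewrite mulr_ge0 ?sqr_ge0// ltW.
  have -> : mu * (norm2 l - k * norm2 y / mu) ^+ 2 =
     mu * norm2 l ^+ 2 - 2 * (k * norm2 y * norm2 l) + k ^+ 2 / mu * norm2 y ^+ 2.
    by field; rewrite gt_eqF.
  lra.
set p := mu * _ - _ in pert *.
have lnu : 0 < lam * nu by rewrite mulr_gt0.
have lpert := ler_wpM2l (ltW lam0) pert.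
rewrite ge_max -/rs; apply/andP; split; last first.
  have := ler_wpM2r yy0 l1; lra.
suff : 0 <= g + lam * nu + lam * p by lra.
(* Up to e, l is small and the reserve lambda nu pays for both negative terms; beyond e, the gap
   itself absorbs lambda C1 ||y||^2. *)
have [ge|ge] := lerP g e.
  have lt := small ge.
  have y3 : norm2 y <= Y2.
    rewrite -norm2_sqr in y2.
    have : norm2 y ^+ 2 <= Y2.
      apply: le_trans y2 _; have := ler_wpM2l th0 (le_trans ge e1); rewrite /Y2; lra.
    nra.
  have pk : - (nu / 2) <= p.
    have h1 : norm2 y * norm2 l <= Y2 * tau by apply: ler_pM.
    have h2 : k * (Y2 * tau) <= nu / 4.
      rewrite /tau; have -> : k * (Y2 * (nu / (4 * (k + 1) * Y2))) = nu / 4 * (k / (k + 1)).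
        by field; rewrite !gt_eqF//; lra.
      by rewrite ler_piMr ?ler_pdivrMr//; lra.
    have h3 := ler_wpM2l k0 h1.
    have : 0 <= mu * dot l l by rewrite mulr_ge0// ltW.
    rewrite /p; lra.
  have := ler_wpM2l (ltW lam0) pk; lra.
have a1 := ler_wpM2l (mulr_ge0 (ltW lam0) C10) y2.
have g0 : 0 <= g by apply: ltW; apply: lt_trans ge.
have := ler_wpM2r g0 l2; lra.
Qed.

End certificate.

(** * Covariance of a relation with the noise response *)

Lemma trace_congr_ge0 (R : realType) n m (P : 'M[R]_n) (M : 'M[R]_(m, n)) :
  (forall v, 0 <= dot v (P *m v)) -> 0 <= \tr (M *m P *m M^T).
Proof.
move=> P0; apply: sumr_ge0 => i _; have := P0 (row i M)^T.
have -> // : (M *m P *m M^T) i i = dot (row i M)^T (P *m (row i M)^T).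
rewrite /dot trmxK mulmxA -row_mul.
by rewrite !mxE; apply: eq_bigr => j _; rewrite !mxE.
Qed.

Lemma trace_gram_gt0 (R : realType) m n (M : 'M[R]_(m, n)) : M != 0 -> 0 < \tr (M *m M^T).
Proof.
move=> M0; have e : \tr (M *m M^T) = \sum_i \sum_j M i j ^+ 2.
  by apply: eq_bigr => i _; rewrite mxE; apply: eq_bigr => j _; rewrite mxE expr2.
have s0 i : 0 <= \sum_j M i j ^+ 2 by apply: sumr_ge0 => j _; exact: sqr_ge0.
rewrite lt_neqAle e sumr_ge0// andbT eq_sym psumr_eq0//; apply: contra M0 => /allP h.
apply/eqP/matrixP => i j; rewrite mxE; apply/eqP.
have := h i (mem_index_enum _); rewrite /= psumr_eq0; last by move=> k _; exact: sqr_ge0.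
by move=> /allP /(_ j (mem_index_enum _)); rewrite /= sqrf_eq0.
Qed.

Section bounded_horizon.
Context {R : realType} {nx nw : nat}.
Variables (F : 'M[R]_nx) (E : 'M[R]_(nx, nw)) (Sigma_w : 'M[R]_nw) (P : 'M[R]_nx).
Hypothesis Sigma_sym : Sigma_w^T = Sigma_w.
Hypothesis lyapunov : F *m P *m F^T - P + E *m Sigma_w *m E^T = 0.
Hypothesis P_psd : forall v, 0 <= dot v (P *m v).

Let W t := (1%:M : 'M[R]_t) *t Sigma_w.
Let Y t := @noise_response R nx nw F E t.

Lemma trace_noise_response_le t s m (X : 'M[R]_(m, nx)) : (s <= t)%N ->
  \tr ((X *m Y t s) *m W t *m (X *m Y t s)^T) <= \tr (X *m P *m X^T).
Proof.
move=> st; have -> : (X *m Y t s) *m W t *m (X *m Y t s)^T =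
    X *m P *m X^T - (X *m F ^+ s) *m P *m (X *m F ^+ s)^T.
  have := noise_response_var Sigma_sym lyapunov st; rewrite -/(Y t) -/(W t) => h.
  rewrite !trmx_mul -!mulmxA [Y t s *m (_ *m _)]mulmxA [Y t s *m W t *m _]mulmxA h.
  by rewrite mulmxBl mulmxBr !mulmxA.
by rewrite linearB/= gerBl trace_congr_ge0.
Qed.

Variables (X0 X1 : 'M[R]_nx) (j : nat).

Let L t := X0 *m Y t t + X1 *m (Y t (t - j.+1)%N - Y t (t - j.+2)%N).
(** The limit of the covariance of the relation with y_t when the powers of F tend to 0. *)
Let N := X0 *m P + X1 *m (P *m (F ^+ j.+1)^T - P *m (F ^+ j.+2)^T).

Lemma relation_cov t : (j.+2 <= t)%N -> L t *m W t *m (Y t t)^T =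
  N - (X0 *m F ^+ t + X1 *m (F ^+ (t - j.+1) - F ^+ (t - j.+2))) *m P *m (F ^+ t)^T.
Proof.
move=> jt; have cov k : (k <= t)%N -> Y t (t - k)%N *m W t *m (Y t t)^T =
    P *m (F ^+ k)^T - F ^+ (t - k) *m P *m (F ^+ t)^T.
  move=> kt; have := noise_response_cov (t := t) Sigma_sym lyapunov (s := (t - k)%N) (k := k).
  rewrite subnK// leqnn => /(_ isT); rewrite -/(Y t) -/(W t) => ->.
  by rewrite mulmxBl -[_ *m _ *m (F ^+ k)^T]mulmxA -trmx_mul mulmxE -exprD addnC subnK.
have h0 := cov 0%N isT; rewrite subn0 expr0 trmx1 mulmx1 in h0.
have h1 := cov j.+1 (ltnW jt); have h2 := cov j.+2 jt.
rewrite /L /N !mulmxDl -!mulmxA !mulmxDl !mulNmx ![Y _ _ *m (W t *m _)]mulmxA h0 h1 h2.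
rewrite -!mulmxA !(mulmxDr, mulmxDl, mulmxN, mulNmx).
move: (X0 *m P) (X0 *m (F ^+ t *m (P *m (F ^+ t)^T))) => M1 M2.
apply/matrixP => p q; rewrite !mxE; ring.
Qed.

(** The remainder in [relation_cov] carries a factor F^t, so it eventually costs at most a quarter
    of Tr (N N^T). *)
Lemma relation_cov_trace a : 0 <= a -> a < 1 -> opbound F a -> N != 0 ->
  exists T, forall t, (T <= t)%N -> (j.+2 <= t)%N ->
  3 / 4 * \tr (N *m N^T) <= \tr (L t *m W t *m (Y t t)^T *m N^T).
Proof.
move=> a0 a1 Fa N0; have N_gt0 := trace_gram_gt0 N0.
have [k0 k00 X0k] := opbound_exists X0; have [k1 k10 X1k] := opbound_exists X1.
have [kP kP0 Pk] := opbound_exists P; have [kN kN0 Nk] := opbound_exists N^T.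
have F1 i : opbound (F ^+ i) 1.
  by apply: opboundW (opbound_exp i a0 Fa); rewrite exprn_ile1// ltW.
have K0 : 0 <= k0 * 1 + k1 * (1 + 1) by rewrite addr_ge0 ?mulr_ge0 ?addr_ge0.
have [T hT] := geometric_eventually_le (nx%:R * ((k0 * 1 + k1 * (1 + 1)) * kP * kN)) a0 a1
  (divr_gt0 N_gt0 (ltr0n R 4)).
exists T => t Tt jt; rewrite relation_cov// mulmxBl linearB/=.
set X := _ *m N^T in |- *.
have Rk : opbound ((X0 *m F ^+ t + X1 *m (F ^+ (t - j.+1) - F ^+ (t - j.+2))) *m P *m (F ^+ t)^T *m N^T)
    ((k0 * 1 + k1 * (1 + 1)) * kP * a ^+ t * kN).
  apply: opboundM Nk; first by rewrite !mulr_ge0 ?exprn_ge0.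
  apply: opboundM (opbound_tr (exprn_ge0 t a0) (opbound_exp t a0 Fa)); first by rewrite mulr_ge0.
  apply: opboundM Pk => //.
  apply: opboundD; first exact: opboundM X0k (F1 t).
  by apply: opboundM X1k _ => //; apply: opboundD (opboundN _).
have := trace_opbound _ Rk; rewrite ler_norml => /(_ _)/andP[]; first by rewrite !mulr_ge0 ?exprn_ge0.
have := hT t Tt; lra.
Qed.

(** ||u + v||^2 <= 2 ||u||^2 + 2 ||v||^2, used twice. The bound is uniform in t, which lets [mu] be
    fixed before t. *)
Lemma relation_var t : (forall n (A : 'M[R]_(n, t * nw)), 0 <= \tr (A *m W t *m A^T)) ->
  \tr (L t *m W t *m (L t)^T) <= 2 * \tr (X0 *m P *m X0^T) + 8 * \tr (X1 *m P *m X1^T).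
Proof.
move=> W0.
have par (A B : 'M[R]_(nx, t * nw)) : \tr ((A + B) *m W t *m (A + B)^T) <=
    2 * \tr (A *m W t *m A^T) + 2 * \tr (B *m W t *m B^T).
  have := W0 _ (A - B); rewrite [(A - B)^T]linearB [(A + B)^T]linearD/=.
  rewrite !(mulmxDl, mulmxDr, mulNmx, mulmxN) !(mxtraceD, linearN)/=.
  lra.
have h0 := trace_noise_response_le X0 (leqnn t).
have h1 := trace_noise_response_le X1 (leq_subr j.+1 t).
have h2 := trace_noise_response_le X1 (leq_subr j.+2 t).
have g1 := par (X0 *m Y t t) (X1 *m (Y t (t - j.+1)%N - Y t (t - j.+2)%N)).
have g2 := par (X1 *m Y t (t - j.+1)%N) (- (X1 *m Y t (t - j.+2)%N)).
rewrite -mulmxBr linearN/= mulmxN !mulNmx opprK in g2.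
rewrite /L; lra.
Qed.

End bounded_horizon.

Section certificate_matrix.
Context {R : realType} {n m : nat}.
Variables (N : 'M[R]_n) (Y L : 'M[R]_(n, m)) (rs lam mu : R).

Definition certificate_mx : 'M[R]_m :=
  rs *: (Y^T *m Y) + lam *: (mu *: (L^T *m L) - 2 *: ((N *m Y)^T *m L)).

Lemma dot_certificate v : dot v (certificate_mx *m v) =
  rs * dot (Y *m v) (Y *m v)
  + lam * (mu * dot (L *m v) (L *m v) - 2 * dot (N *m (Y *m v)) (L *m v)).
Proof.
rewrite mulmxDl -!scalemxAl mulmxBl -!scalemxAl !dot_expand.
by rewrite (mulmxA N Y v) !dot_mulmx.
Qed.

Lemma trace_certificate W : \tr (certificate_mx *m W) =
  rs * \tr (Y *m W *m Y^T)
  + lam * (mu * \tr (L *m W *m L^T) - 2 * \tr (L *m W *m Y^T *m N^T)).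
Proof.
rewrite mulmxDl -!scalemxAl mulmxBl -!scalemxAl.
rewrite mxtraceD mxtraceZ mxtraceZ linearB/= !mxtraceZ trmx_mul -!mulmxA.
rewrite [\tr (Y^T *m (Y *m _))]mxtrace_mulC [\tr (L^T *m _)]mxtrace_mulC.
rewrite [Y^T *m (N^T *m _)]mulmxA [\tr (_ *m (L *m _))]mxtrace_mulC.
by rewrite -!mulmxA.
Qed.

End certificate_matrix.

(** * From majorants of the loss to ultimate boundedness *)

Section ultimate_bound.
Context {R : realType} {nx nw : nat}.
Variables (F Q : 'M[R]_nx) (E : 'M[R]_(nx, nw)) (Sigma_w : 'M[R]_nw) (P : 'M[R]_nx).
Variables (a c sp eps : R) (x0 : 'cV[R]_nx).
Variable x : forall t : nat, (t * nw).-tuple R -> 'cV[R]_nx.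
Hypothesis Sigma_sym : Sigma_w^T = Sigma_w.
Hypothesis lyapunov : F *m P *m F^T - P + E *m Sigma_w *m E^T = 0.
Hypothesis P_psd : forall v, 0 <= dot v (P *m v).
Hypotheses (c0 : 0 < c) (sp0 : 0 < sp) (eps0 : 0 < eps) (a0 : 0 <= a) (a1 : a < 1).
Hypothesis Fa : opbound F a.
Hypothesis trP : \tr P = eps * sp ^+ 2.

Let W t := (1%:M : 'M[R]_t) *t Sigma_w.
Let Y t := @noise_response R nx nw F E t.

Hypothesis x_decomposed : forall t v, exists z xhat,
  decomposed F Q a c x0 z (fun s => Y t s *m vec v) xhat /\ x v = z t + Y t t *m vec v.

Let bounded t := (worst_case_CVaR (disturbance_ambiguity_set Sigma_w t) eps
  (fun wbar => norm2 (x wbar) ^+ 2 - (c + sp) ^+ 2)%R <= 0)%E.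

(** Write r = c + sp. For beta = - r sp, the value of Tr P gives beta + (r / sp) Tr P / eps = 0, so
    a majorant of expectation at most (r / sp) Tr P suffices. *)
Lemma bounded_of_quadratic t (q : R) (S : 'M[R]_(t * nw)) :
  (forall v : (t * nw).-tuple R, Num.max (dot (x v) (x v) - (c + sp) * c) 0 <= q + dot (vec v) (S *m vec v)) ->
  (forall P', moment_ambiguity_set (W t) P' -> q + \tr (S *m W t) <= (c + sp) / sp * \tr P) ->
  bounded t.
Proof.
move=> hq hS; apply: (worst_case_CVaR_le0 (beta := - ((c + sp) * sp)) (q := q) (S := S)) => //.
  move=> v; apply: le_trans (hq v); rewrite norm2_sqr opprK.
  by have -> : dot (x v) (x v) - (c + sp) ^+ 2 + (c + sp) * sp = dot (x v) (x v) - (c + sp) * c by ring.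
move=> P' /hS h; have ei : 0 <= eps^-1 by rewrite invr_ge0 ltW.
apply: le_trans (_ : - ((c + sp) * sp) + eps^-1 * ((c + sp) / sp * \tr P) <= 0).
  by rewrite lerD2l ler_wpM2l.
rewrite trP; have -> : eps^-1 * ((c + sp) / sp * (eps * sp ^+ 2)) = (c + sp) * sp.
  by field; rewrite !gt_eqF.
by rewrite addNr.
Qed.

(** If ||z_t|| <= c, the gap is nonnegative, and (r / sp) ||y_t||^2 alone dominates the loss. *)
Lemma bounded_of_drift t :
  (forall z y xhat, decomposed F Q a c x0 z y xhat -> norm2 (z t) <= c) -> bounded t.
Proof.
move=> hz; have rs : 0 <= (c + sp) / sp by rewrite divr_ge0 ?addr_ge0// ltW.
apply: (@bounded_of_quadratic t 0 ((c + sp) / sp *: ((Y t t)^T *m Y t t))) => [v|P' _].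
  rewrite add0r -scalemxAl dotZr -dot_mulmx.
  have [z [xhat [dec ->]]] := x_decomposed v; rewrite ge_max mulr_ge0 ?dot_ge0// andbT.
  have zc := hz _ _ _ dec; have := gapE (z t) (Y t t *m vec v) c0 sp0; rewrite /gap.
  have : 0 <= (c + sp) / c * (c ^+ 2 - dot (z t) (z t)).
    apply: mulr_ge0; first by rewrite divr_ge0 ?addr_ge0// ltW.
    by rewrite -norm2_sqr subr_ge0 ler_pXn2r// nnegrE ?norm2_ge0// ltW.
  have : 0 <= c / sp * dot ((sp / c) *: z t - Y t t *m vec v) ((sp / c) *: z t - Y t t *m vec v).
    by rewrite mulr_ge0 ?dot_ge0// divr_ge0// ltW.
  lra.
rewrite add0r -scalemxAl linearZ/= ler_wpM2l// -mulmxA mxtrace_mulC.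
by have := trace_noise_response_le Sigma_sym lyapunov P_psd 1%:M (leqnn t); rewrite trmx1 mulmx1 !mul1mx.
Qed.

(** The parameters are fixed in the order mu, tau, e, lambda. Only then is T taken so large that the
    relation is available, the transient is below lambda nu / 2 and the covariance is near N. *)
Lemma bounded_of_tight_relation X0 X1 j : tight_relation F Q a c sp x0 X0 X1 j ->
  X0 *m P + X1 *m (P *m (F ^+ j.+1)^T - P *m (F ^+ j.+2)^T) != 0 ->
  exists T, forall t, (T <= t)%N -> bounded t.
Proof.
set N := X0 *m P + _ => tight N0; have nu0 := trace_gram_gt0 N0; set nu := \tr _ in nu0.
pose H := 2 * \tr (X0 *m P *m X0^T) + 8 * \tr (X1 *m P *m X1^T).
have H0 : 0 <= H.
  by rewrite addr_ge0 ?mulr_ge0// trace_congr_ge0.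
pose mu := nu / (4 * (H + 1)).
have H1 : 0 < 4 * (H + 1) by rewrite mulr_gt0// ltr_wpDl.
have mu0 : 0 < mu by rewrite divr_gt0.
have muH : mu * H <= nu / 4.
  rewrite /mu mulrAC ler_pdivrMr//; move: (ltW nu0) H0; lra.
pose D := norm2 x0; have D0 : 0 <= D by exact: norm2_ge0.
have [tau tau0 cert] := quadratic_certificate c0 sp0 N (c + D) nu0 mu0.
have [e [T1 [e01 jT1 hT1]]] := tight tau tau0.
have [lam lam0 {}cert] := cert e e01.
have lnu : 0 < lam * nu / 2 by rewrite divr_gt0// mulr_gt0.
(* By [gapE], a^t times this constant bounds how far the gap can fall below 0. *)
have [T2 hT2] := geometric_eventually_le ((c + sp) / c * ((2 * c + D) * D)) a0 a1 lnu.
have [T3 hT3] := relation_cov_trace Sigma_sym lyapunov a0 a1 Fa N0.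
exists (T1 + T2 + T3)%N => t Tt.
have tT1 : (T1 <= t)%N by apply: leq_trans Tt; rewrite -addnA leq_addr.
have tT2 : (T2 <= t)%N by apply: leq_trans Tt; rewrite addnAC leq_addl.
have tT3 : (T3 <= t)%N by apply: leq_trans Tt; rewrite leq_addl.
have jt := leq_trans jT1 tT1.
pose L := X0 *m Y t t + X1 *m (Y t (t - j.+1)%N - Y t (t - j.+2)%N).
apply: (@bounded_of_quadratic t (lam * nu)
  (certificate_mx N (Y t t) L ((c + sp) / sp) lam mu)) => [v|P' hP'].
  rewrite dot_certificate.
  have [z [xhat [dec ->]]] := x_decomposed v.
  have hz := decomposed_bound t a0 Fa dec; rewrite -/D in hz.
  have at0 : 0 <= a ^+ t by exact: exprn_ge0.
  have at1 : a ^+ t <= 1 by rewrite exprn_ile1// ltW.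
  have atc : 0 <= a ^+ t * c by rewrite mulr_ge0// ltW.
  have hz1 : norm2 (z t) <= c + a ^+ t * D by lra.
  apply: cert.
  - by apply: le_trans hz1 _; rewrite lerD2l ler_piMl.
  - move=> hg; have := hT1 t z _ xhat tT1 dec hg.
    by rewrite /L mulmxDl -!mulmxA mulmxBl.
  - have := gapE (z t) (Y t t *m vec v) c0 sp0 => ->.
    have : 0 <= c / sp * dot ((sp / c) *: z t - Y t t *m vec v) ((sp / c) *: z t - Y t t *m vec v).
      by rewrite mulr_ge0 ?dot_ge0// divr_ge0// ltW.
    suff : - (a ^+ t * ((c + sp) / c * ((2 * c + D) * D))) <= (c + sp) / c * (c ^+ 2 - dot (z t) (z t)).
      by have := hT2 t tT2; lra.
    have -> : a ^+ t * ((c + sp) / c * ((2 * c + D) * D)) = (c + sp) / c * (a ^+ t * ((2 * c + D) * D)) by ring.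
    rewrite -mulrN ler_wpM2l//; first by rewrite divr_ge0 ?addr_ge0// ltW.
    rewrite -norm2_sqr; have zn := norm2_ge0 (z t).
    have z2 : norm2 (z t) ^+ 2 <= (c + a ^+ t * D) ^+ 2 by rewrite ler_pXn2r// nnegrE (le_trans zn).
    have : (a ^+ t * D) * (a ^+ t * D) <= a ^+ t * D * D.
      by apply: ler_wpM2l; [rewrite mulr_ge0|rewrite ler_piMl].
    lra.
have W0 n (A : 'M[R]_(n, t * nw)) : 0 <= \tr (A *m W t *m A^T).
  exact: moment_ambiguity_set_trace_ge0 hP' _ A.
have hL := relation_var Sigma_sym lyapunov P_psd X0 X1 j W0.
have hN := hT3 t tT3 jt.
have hY : \tr (Y t t *m W t *m (Y t t)^T) <= \tr P.
  by have := trace_noise_response_le Sigma_sym lyapunov P_psd 1%:M (leqnn t); rewrite trmx1 mulmx1 !mul1mx.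
rewrite trace_certificate; move: hL hN hY; rewrite -/H -/(W t) -/(Y t) -/L -/N -/nu.
move: (\tr (L *m _ *m _)) (\tr (L *m _ *m _ *m _)) (\tr (Y t t *m _ *m _)) => tL tN tY hL hN hY.
have g1 : (c + sp) / sp * tY <= (c + sp) / sp * \tr P.
  by rewrite ler_wpM2l// divr_ge0 ?addr_ge0// ltW.
have g2 := ler_wpM2l (ltW mu0) hL.
(* mu tL <= nu / 4 and 2 tN >= 3 nu / 2 outweigh the added constant lambda nu. *)
have : lam * (nu + (mu * tL - 2 * tN)) <= lam * 0.
  by apply: ler_wpM2l; [exact: ltW|move: (ltW nu0); lra].
lra.
Qed.

End ultimate_bound.

(** * Existence of a nondegenerate relation *)

Lemma posdefmx_unit (R : realType) n (P : 'M[R]_n) : posdefmx P -> P \in unitmx.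
Proof.
move=> [Psym Ppos]; rewrite -row_free_unit -kermx_eq0; apply/negPn/negP => /rowV0Pn[u].
move=> /sub_kermxP uP u0; have := Ppos u^T; rewrite trmx_eq0 => /(_ u0).
by rewrite trmxK uP mul0mx mxE ltxx.
Qed.

Lemma posdefmx_ge0 (R : realType) n (P : 'M[R]_n) v : posdefmx P -> 0 <= dot v (P *m v).
Proof.
move=> [_ Ppos]; have [->|v0] := eqVneq v 0; first by rewrite mulmx0 dotE big1// => i _; rewrite !mxE mul0r.
by rewrite /dot mulmxA ltW// Ppos.
Qed.

Lemma posdefmx_trace_gt0 (R : realType) n (P : 'M[R]_n) (i : 'I_n) : posdefmx P -> 0 < \tr P.
Proof.
move=> PP; have diag k : 0 < P k k.
  have := PP.2 (delta_mx k 0); rewrite trmx_delta -rowE -colE !mxE; apply.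
  by apply/eqP => /matrixP/(_ k 0)/eqP; rewrite !mxE !eqxx oner_eq0.
by rewrite /mxtrace (bigD1 i)//= ltr_wpDr// sumr_ge0// => k _; exact: ltW.
Qed.

Lemma trmx_exp (R : comPzRingType) n (M : 'M[R]_n) k : (M ^+ k)^T = M^T ^+ k.
Proof.
elim: k => [|k IH]; first by rewrite !expr0 trmx1.
by rewrite exprS exprSr -!mulmxE trmx_mul IH.
Qed.

Lemma exp_scalemx (R : comPzRingType) n (k : R) (M : 'M[R]_n) i : (k *: M) ^+ i = k ^+ i *: M ^+ i.
Proof.
elim: i => [|i IH]; first by rewrite !expr0 scale1r.
by rewrite !exprS -!mulmxE IH -scalemxAl -scalemxAr scalerA.
Qed.

(* [V] being orthogonal, the matrix [G (1 - V) V ^ j] keeps the norm of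
   [G (1 - V)], while the hypothesis bounds it by a multiple of [a ^ j]. *)
Lemma orthogonal_relations_trivial (R : realType) n (V G Q P : 'M[R]_n) (a : R) :
  0 < a -> a < 1 -> V^T *m V = 1%:M -> P \in unitmx ->
  (forall j, G *m (V ^+ j - V ^+ j.+1) *m P
     + Q *m (a ^+ j.+1 *: (P *m V ^+ j.+1) - a ^+ j.+2 *: (P *m V ^+ j.+2)) = 0) ->
  Q = 0.
Proof.
move=> a0 a1 VV Pu h; have VV' := mulmx1C VV.
have isoV (u : 'cV[R]_n) : norm2 (V^T *m u) = norm2 u.
  apply/eqP; rewrite -(@eqrXn2 _ 2) ?norm2_ge0//.
  by rewrite !norm2_sqr dot_mulmx trmxK VV' mul1mx.
have isoVj j (u : 'cV[R]_n) : norm2 ((V ^+ j)^T *m u) = norm2 u.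
  rewrite trmx_exp; elim: j => [|j IH]; first by rewrite expr0 mul1mx.
  by rewrite exprS -mulmxE -mulmxA isoV IH.
pose Y := G *m (1%:M - V); pose Z := - (a *: (Q *m P *m (1%:M - a *: V) *m V)).
have YV j : Y *m V ^+ j = a ^+ j *: (Z *m V ^+ j *m invmx P).
  have e1 : V ^+ j - V ^+ j.+1 = (1%:M - V) *m V ^+ j by rewrite mulmxBl mul1mx exprS.
  have e2 : a ^+ j.+1 *: (P *m V ^+ j.+1) - a ^+ j.+2 *: (P *m V ^+ j.+2) =
      a ^+ j *: (a *: (P *m (1%:M - a *: V) *m V *m V ^+ j)).
    have -> : P *m (1%:M - a *: V) *m V *m V ^+ j = P *m V ^+ j.+1 - a *: (P *m V ^+ j.+2).
      rewrite -[_ *m V *m _]mulmxA !mulmxE -exprS -!mulmxE mulmxBr mulmx1 mulmxBl.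
      by rewrite -scalemxAr -scalemxAl -mulmxA mulmxE -exprS.
    by rewrite !scalerBr !scalerA -!exprSr.
  have := h j; rewrite e1 e2 => /eqP; rewrite addr_eq0 => /eqP h1.
  apply: (can_inj (mulmxK Pu)); rewrite -scalemxAl mulmxKV//.
  rewrite /Y -mulmxA h1 /Z !mulNmx scalerN -!scalemxAr -!scalemxAl -!mulmxA.
  by congr (- _).
have Y0 : Y = 0.
  have [k k0 Pk] := opbound_exists (invmx P)^T.
  apply: trmx_inj; rewrite trmx0; apply: mulmx_cV_eq0 => v.
  apply: norm2_le0; apply/ler_addgt0Pr => d d0.
  have [T hT] := geometric_eventually_le (k * norm2 (Z^T *m v)) (ltW a0) a1 d0.
  rewrite add0r; apply: le_trans (hT T (leqnn _)).
  rewrite -(isoVj T) mulmxA -trmx_mul YV linearZ/= -scalemxAl norm2Z ger0_norm ?exprn_ge0 ?(ltW a0)//.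
  rewrite ler_wpM2l ?exprn_ge0 ?(ltW a0)// !trmx_mul -!mulmxA.
  by apply: le_trans (Pk _) _; rewrite isoVj.
have Z0 : Z = 0.
  have := YV 0%N; rewrite Y0 mul0mx expr0 scale1r mulmx1 => /esym/(congr1 (mulmx^~ P)).
  by rewrite mulmxKV// mul0mx.
have QPV : Q *m P = a *: (Q *m P *m V).
  have : Q *m P *m (1%:M - a *: V) *m V = 0.
    by move/eqP: Z0; rewrite oppr_eq0 scaler_eq0 gt_eqF//= => /eqP.
  move/(congr1 (mulmx^~ V^T)); rewrite mul0mx -mulmxA VV' mulmx1 mulmxBr mulmx1 -scalemxAr.
  by move/eqP; rewrite subr_eq0 => /eqP.
(* V^T preserves norms, so QP = a QP V with a < 1 leaves only 0. *)
have QP0 : Q *m P = 0.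
  apply: trmx_inj; rewrite trmx0; apply: mulmx_cV_eq0 => v; apply: norm2_le0.
  have : norm2 ((Q *m P)^T *m v) = a * norm2 ((Q *m P)^T *m v).
    by rewrite {1}QPV linearZ/= trmx_mul -scalemxAl norm2Z gtr0_norm// -mulmxA isoV.
  have := norm2_ge0 ((Q *m P)^T *m v); nra.
by rewrite -(mulmxK Pu Q) QP0 mul0mx.
Qed.

(** * Case distinction on ||A + BK||, BK and the orthogonality of V *)

Theorem corollaryV2 (R : realType) (nx nu nw : nat)
    (A : 'M[R]_nx) (B : 'M[R]_(nx, nu)) (E : 'M[R]_(nx, nw))
    (K : 'M[R]_(nu, nx)) (Sigma_w : 'M[R]_nw) (eps : R)
    (P : 'M[R]_nx) (r sigma2 : R) :
  posdefmx Sigma_w ->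
  0 < eps < 1 ->
  max_singular_value (A + B *m K) < 1 ->
  reachable (A + B *m K) E ->
  B != 0 ->
  posdefmx P ->
  (A + B *m K) *m P *m (A + B *m K)^T - P + E *m Sigma_w *m E^T = 0 ->
  0 < r ->
  eps^-1 * \tr P < r ^+ 2 ->
  sigma2 <= (1 - max_singular_value (A + B *m K)) / max_singular_value B
            * (r - Num.sqrt (eps^-1 * \tr P)) ->
  forall (x0 : 'cV[R]_nx)
         (x : forall t : nat, (t * nw).-tuple R -> 'cV[R]_nx),
    event_triggered_state A B E K sigma2 x0 x ->
    exists T : nat, (0 < T)%N /\
      forall t : nat, (T <= t)%N ->
        (worst_case_CVaR (disturbance_ambiguity_set Sigma_w t) eps
           (fun wbar => norm2 (x t wbar) ^+ 2 - r ^+ 2)%R <= 0)%E.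
Proof.
move=> SP /andP[eps0 _] a1 _ B0 PP lyap r0 trr hsigma x0 x hx.
set F := A + B *m K in a1 lyap hsigma; set a := max_singular_value F in a1 hsigma.
have Fa : opbound F a := @max_singular_value_opbound _ _ _ F.
have Bb := @max_singular_value_opbound _ _ _ B; set b := max_singular_value B in Bb hsigma.
pose Q := B *m K; set sp := Num.sqrt _ in hsigma; pose c := r - sp.
(* B != 0 provides an index, so the state space is nonzero and Tr P > 0. *)
have [i _] : exists i : 'I_nx, True.
  by apply/not_existsP => h; move/eqP: B0; apply; apply/matrixP => i; case: (h i).
have trP0 := posdefmx_trace_gt0 i PP.
have p0 : 0 < eps^-1 * \tr P by rewrite mulr_gt0// invr_gt0.
have sp0 : 0 < sp by rewrite sqrtr_gt0.
have sp2 : sp ^+ 2 = eps^-1 * \tr P by rewrite sqr_sqrtr// ltW.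
have c0 : 0 < c.
  by rewrite subr_gt0 -(@ltr_pXn2r _ 2) ?nnegrE ?(ltW sp0) ?(ltW r0)// sp2.
have rE : r = c + sp by rewrite subrK.
have trP : \tr P = eps * sp ^+ 2 by rewrite sp2 mulVKf// gt_eqF.
have a0 : 0 <= a.
  have := Fa (delta_mx i 0); have := norm2_ge0 (F *m delta_mx i 0).
  have [n0|n0 h1 h2] := lerP (norm2 (delta_mx i 0 : 'cV[R]_nx)) 0.
    have /matrixP/(_ i 0)/eqP := norm2_le0 n0.
    by rewrite !mxE !eqxx oner_eq0.
  by rewrite -(pmulr_lge0 _ n0) (le_trans h1).
have b0 : 0 < b.
  rewrite ltNge; apply/negP => b0; move/eqP: B0; apply; apply: mulmx_cV_eq0 => v.
  by apply: norm2_le0; apply: le_trans (Bb _) _; rewrite mulr_le0_ge0 ?norm2_ge0.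
have sb : b * Num.max sigma2 0 <= (1 - a) * c.
  have [_|_] := lerP sigma2 0; first by rewrite mulr0; apply: mulr_ge0 (ltW c0); rewrite subr_ge0 ltW.
  by rewrite mulrC -ler_pdivlMr// mulrAC.
(* The noise sequence realising [v] is [unstack v], zero after the horizon; z is x minus the noise
   response. *)
have x_decomposed t v : exists z xhat,
    decomposed F Q a c x0 z (fun s => noise_response F E t s *m vec v) xhat /\
    x t v = z t + noise_response F E t t *m vec v.
  have [xhat [xx0 xxS xe xtr]] := trajectory_feedback (hx (unstack v)).
  pose y s := noise_response F E t s *m vec v.
  exists (fun s => x s (stack (unstack v) s) - y s), xhat; split; last by rewrite subrK stack_unstack.
  split=> [|s|s|s]; rewrite ?subrK//.
  - by rewrite xx0 /y mul0mx subr0.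
  - rewrite xxS -/F -/Q unstackE /y/= mulmxDl -!mulmxA mulmxBr.
    by rewrite [F *m (_ - _)]mulmxBr opprD addrACA subrr addr0 addrAC.
  - by rewrite -mulmxA; apply: le_trans (Bb _) _; apply: le_trans sb; rewrite ler_pM2l.
suff [T hT] : exists T, forall t, (T <= t)%N ->
    (worst_case_CVaR (disturbance_ambiguity_set Sigma_w t) eps
       (fun wbar => norm2 (x t wbar) ^+ 2 - (c + sp) ^+ 2)%R <= 0)%E.
  by exists T.+1; split=> // t /ltnW/hT; rewrite -rE.
have Ppsd v := posdefmx_ge0 v PP; have Pu := posdefmx_unit PP.
have drift := @bounded_of_drift _ _ _ F Q E Sigma_w P a c sp eps x0 x SP.1 lyap Ppsd c0 sp0 eps0 trP x_decomposed.
have relation := @bounded_of_tight_relation _ _ _ F Q E Sigma_w P a c sp eps x0 x SP.1 lyap Ppsd c0 sp0 eps0 a0 a1 Fa trP x_decomposed.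
(* If a = 0, the initial state is forgotten after one step. *)
move: a0; rewrite le_eqVlt => /predU1P[aE|a_gt0].
  exists 1%N => t t1; apply: drift => z y xhat dec.
  apply: le_trans (decomposed_bound t _ Fa dec) _; rewrite -aE//.
  by rewrite expr0n -leqn0 leqNgt t1 !mul0r addr0 subr0.
(* If BK = 0, no triggering error enters and ||z_t|| <= a^t ||x0|| falls below c. *)
have [Q0|Q0] := eqVneq Q 0.
  have [T hT] := geometric_eventually_le (norm2 x0) (ltW a_gt0) a1 c0.
  exists T => t Tt; apply: drift => z y xhat [z0 zS _ _]; apply: le_trans (hT t Tt).
  elim: t {Tt} => [|t IH]; first by rewrite z0 expr0 mul1r.
  rewrite zS Q0 mul0mx addr0; apply: le_trans (Fa _) _.
  by rewrite exprS -mulrA ler_wpM2l// ltW.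
pose V := a^-1 *: F^T.
(* If V is not orthogonal, N = (1 - V^T V) P is nonzero because P is invertible. *)
have [VV|VV] := eqVneq (V^T *m V) 1%:M; last first.
  apply: (relation _ _ _ (tight_relation_isometry Q x0 a_gt0 a1 c0 sp0 Fa)).
  rewrite mul0mx addr0; apply: contra VV => /eqP/(congr1 (mulmx^~ (invmx P))).
  by rewrite mulmxK// mul0mx => /eqP; rewrite subr_eq0 eq_sym.
pose G := (c / sp) *: ((1 - a)%:M + Q *m V).
(* For orthogonal V some relation of the second kind has N != 0; otherwise
   [orthogonal_relations_trivial] would give BK = 0. *)
have [[k Nk]|Nk] := pselect (exists k,
    (c / sp) *: (((1 - a)%:M + Q *m V) *m (V ^+ k - V ^+ k.+1)) *m P
    + Q *m (P *m (F ^+ k.+1)^T - P *m (F ^+ k.+2)^T) != 0).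
  exact: (relation _ _ _ (tight_relation_no_trigger Q x0 k a_gt0 a1 c0 sp0 Fa) Nk).
have FV k : (F ^+ k)^T = a ^+ k *: V ^+ k.
  rewrite trmx_exp -exp_scalemx /V scalerA mulfV ?gt_eqF// scale1r//.
move/eqP: Q0; case; apply: (orthogonal_relations_trivial (G := G) a_gt0 a1 VV Pu) => k.
apply/eqP/negPn/negP => h; apply: Nk; exists k.
by rewrite scalemxAl !FV -2!(scalemxAr _ P).
Qed.
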